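(* Let $\mathcal{C}$ be a semi-abelian category satisfying the ''Huq = Smith'' condition. There is a bicategory $\mathcal{B}(\mathcal{C})$ with internal crossed modules in $\mathcal{C}$ as objects, butterflies as 1-cells and morphisms of butterflies as 2-cells (with composition of butterflies and identity butterflies as defined in the context).
   Context: **Conventions.** The composite of $f\colon A\to B$ and $g\colon B\to C$ is written $f\cdot g$ or $fg$. ''Bicategory'' means bicategory with invertible 2-cells. **Base category.** $\mathcal{C}$ is semi-abelian: pointed, with finite coproducts, (Bourn) protomodular and (Barr) exact. Two subobjects $g\colon G\to E$, $h\colon H\to E$ commute (Huq) if there is $\varphi\colon G\times H\to E$ with $\langle 1,0\rangle\varphi=g$, $\langle 0,1\rangle\varphi=h$. Two equivalence relations $(R,r_1,r_2)$, $(S,s_1,s_2)$ on $E$, with reflexivity maps $e_R,e_S$, commute (Smith) if there is $\Phi\colon R\times_{r_2,s_1}S\to E$ with $\langle 1,r_2e_S\rangle\Phi=r_1$ and $\langle s_1e_R,1\rangle\Phi=s_2$. ''Huq = Smith'': two equivalence relations on the same object commute (Smith) whenever their normalizations $\ker(r_2)\cdot r_1$ and $\ker(s_2)\cdot s_1$ commute (Huq). **Actions.** $j_{B,X}\colon B\flat X\to B+X$ is the kernel of $[1,0]\colon B+X\to B$; $B\flat(-)$ is a monad on $\mathcal{C}$ and an (internal) action of $B$ on $X$ is an algebra $\xi\colon B\flat X\to X$ for it. The conjugation action is $\chi_X=j_{X,X}\cdot[1,1]\colon X\flat X\to X$. **Crossed modules.** A crossed module $\mathbb{G}$ is a morphism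 $\partial\colon G\to G_0$ with an action $\xi\colon G_0\flat G\to G$ such that $(\partial\flat 1)\xi=\chi_G$ and $(1\flat\partial)\chi_{G_0}=\xi\partial$. Its associated internal groupoid has arrows object $G_1=G\rtimes_\xi G_0$, the coequalizer of $j_{G_0,G}$ and $\xi\cdot i_G\colon G_0\flat G\to G_0+G$, with canonical morphisms $g\colon G\to G_1$, $e\colon G_0\to G_1$; the codomain $c$ is given by $gc=0$, $ec=1$, the domain $d$ by $gd=\partial$, $ed=1$; $i\colon G_1\to G_1$ is the inverse map. **Butterflies.** A butterfly $E=(E,\kappa,\rho,\iota,\sigma)\colon\mathbb{H}\to\mathbb{G}$ consists of an object $E$ and morphisms $\kappa\colon H\to E$, $\rho\colon E\to G_0$, $\iota\colon G\to E$, $\sigma\colon E\to H_0$ with $\kappa\sigma=\partial$, $\iota\rho=\partial$ and: (i) $\kappa\rho=0$; (ii) $\iota=\ker\sigma$ and $\sigma=\mathrm{coker}\,\iota$; (iii) $(1\flat\kappa)\chi_E=(\sigma\flat1)\,\xi\,\kappa\colon E\flat H\to E$; (iv) $(1\flat\iota)\chi_E=(\rho\flat 1)\,\xi\,\iota\colon E\flat G\to E$. A morphism of butterflies $E\to E'$ (both $\mathbb{H}\to\mathbb{G}$) is $f\colon E\to E'$ with $\kappa f=\kappa'$, $\iota f=\iota'$, $f\sigma'=\sigma$, $f\rho'=\rho$; such an $f$ is necessarily an isomorphism. **Composition.** For $E\colon\mathbb{H}\to\mathbb{G}$ and $E'\colon\mathbb{G}\to\mathbb{K}$, let $r,s$ be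 the projections of $E\times_{\rho,\sigma'}E'$ and $q\colon E\times_{\rho,\sigma'}E'\to Q$ the cokernel of $\langle\iota,\kappa'\rangle\colon G\to E\times_{\rho,\sigma'}E'$. The composite butterfly $\mathbb{H}\to\mathbb{K}$ is $(Q,\ \langle\kappa,0\rangle q,\ \overline{s\rho'},\ \langle0,\iota'\rangle q,\ \overline{r\sigma})$, where $q\,\overline{r\sigma}=r\sigma$ and $q\,\overline{s\rho'}=s\rho'$. **Identity.** The identity butterfly on $\mathbb{G}$ is $(G_1,\ \kappa=g\,i,\ \rho=d,\ \iota=g,\ \sigma=c)$. Vertical composition of 2-cells is composition in $\mathcal{C}$; horizontal composition of 2-cells and the associativity and unit constraints are induced by the universal properties of the pullbacks and cokernels involved. *)

(* Defs.v *)
Set Implicit Arguments.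
Unset Strict Implicit.
Unset Printing Implicit Defensive.

(* Composition is written in diagrammatic order: [f ;; g] is "first f, then g". *)

Record Category : Type := {
  Ob :> Type;
  Hom : Ob -> Ob -> Type;
  idm : forall A : Ob, Hom A A;
  comp : forall A B D : Ob, Hom A B -> Hom B D -> Hom A D;
  comp_id_l : forall (A B : Ob) (f : Hom A B), comp (idm A) f = f;
  comp_id_r : forall (A B : Ob) (f : Hom A B), comp f (idm B) = f;
  comp_assoc : forall (A B D E : Ob) (f : Hom A B) (g : Hom B D) (h : Hom D E),
    comp (comp f g) h = comp f (comp g h)
}.

Arguments Hom {c} A B.
Arguments idm {c} A.
Arguments comp {c A B D} f g.

Notation "f ;; g" := (comp f g) (at level 40, left associativity).

Section Universal.
Variable C : Category.
Implicit Types A B D T : C.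

Definition IsIso A B (f : Hom A B) : Prop :=
  exists g : Hom B A, f ;; g = idm A /\ g ;; f = idm B.

Definition IsPullback P A B D (p : Hom P A) (q : Hom P B)
    (f : Hom A D) (g : Hom B D) : Prop :=
  p ;; f = q ;; g /\
  forall T (u : Hom T A) (v : Hom T B), u ;; f = v ;; g ->
    exists! w : Hom T P, w ;; p = u /\ w ;; q = v.

Definition IsCoequalizer A B Q (f g : Hom A B) (q : Hom B Q) : Prop :=
  f ;; q = g ;; q /\
  forall T (h : Hom B T), f ;; h = g ;; h -> exists! w : Hom Q T, q ;; w = h.

Definition RegularEpi A B (f : Hom A B) : Prop :=
  exists (R : C) (a b : Hom R A), IsCoequalizer a b f.

Record ZeroObject : Type := {
  zob : C;
  to_zero : forall A, Hom A zob;
  from_zero : forall A, Hom zob A;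
  to_zero_uniq : forall A (f : Hom A zob), f = to_zero A;
  from_zero_uniq : forall A (f : Hom zob A), f = from_zero A
}.

Record Pullback A B D (f : Hom A D) (g : Hom B D) : Type := {
  pb_ob : C;
  pb_fst : Hom pb_ob A;
  pb_snd : Hom pb_ob B;
  pb_square : pb_fst ;; f = pb_snd ;; g;
  pb_pair : forall T (u : Hom T A) (v : Hom T B), u ;; f = v ;; g -> Hom T pb_ob;
  pb_pair_fst : forall T (u : Hom T A) (v : Hom T B) (e : u ;; f = v ;; g),
    pb_pair e ;; pb_fst = u;
  pb_pair_snd : forall T (u : Hom T A) (v : Hom T B) (e : u ;; f = v ;; g),
    pb_pair e ;; pb_snd = v;
  pb_uniq : forall T (w w' : Hom T pb_ob),
    w ;; pb_fst = w' ;; pb_fst -> w ;; pb_snd = w' ;; pb_snd -> w = w'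
}.

Record Coproduct A B : Type := {
  cp_ob : C;
  cp_inl : Hom A cp_ob;
  cp_inr : Hom B cp_ob;
  cp_copair : forall T, Hom A T -> Hom B T -> Hom cp_ob T;
  cp_copair_inl : forall T (u : Hom A T) (v : Hom B T), cp_inl ;; cp_copair u v = u;
  cp_copair_inr : forall T (u : Hom A T) (v : Hom B T), cp_inr ;; cp_copair u v = v;
  cp_uniq : forall T (w w' : Hom cp_ob T),
    cp_inl ;; w = cp_inl ;; w' -> cp_inr ;; w = cp_inr ;; w' -> w = w'
}.

End Universal.

(* A pointed category with finite limits (terminal object and pullbacks) and
   finite coproducts, all of them chosen. *)
Record PointedCategory : Type := {
  pcat :> Category;
  pcat_zero : ZeroObject pcat;
  pcat_pb : forall (A B D : pcat) (f : Hom A D) (g : Hom B D), Pullback f g;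
  pcat_cp : forall A B : pcat, Coproduct A B
}.

Section Pointed.
Variable C : PointedCategory.
Implicit Types A B D E T X Y : C.

Definition Zero : C := zob (pcat_zero C).
Definition toZ A : Hom A Zero := to_zero (pcat_zero C) A.
Definition fromZ A : Hom Zero A := from_zero (pcat_zero C) A.
Definition zero A B : Hom A B := toZ A ;; fromZ B.

Definition Pb A B D (f : Hom A D) (g : Hom B D) : C := pb_ob (pcat_pb f g).
Definition pr1 A B D (f : Hom A D) (g : Hom B D) : Hom (Pb f g) A := pb_fst _.
Definition pr2 A B D (f : Hom A D) (g : Hom B D) : Hom (Pb f g) B := pb_snd _.
Definition pair A B D (f : Hom A D) (g : Hom B D) T (u : Hom T A) (v : Hom T B)
    (e : u ;; f = v ;; g) : Hom T (Pb f g) := pb_pair (pcat_pb f g) e.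

Definition Cp A B : C := cp_ob (pcat_cp A B).
Definition inl A B : Hom A (Cp A B) := cp_inl _.
Definition inr A B : Hom B (Cp A B) := cp_inr _.
Definition copair A B T (u : Hom A T) (v : Hom B T) : Hom (Cp A B) T :=
  cp_copair (pcat_cp A B) u v.
Definition cpmap A B A' B' (f : Hom A A') (g : Hom B B') : Hom (Cp A B) (Cp A' B') :=
  copair (f ;; inl A' B') (g ;; inr A' B').

Definition IsKernel K A B (k : Hom K A) (f : Hom A B) : Prop :=
  k ;; f = zero K B /\
  forall T (u : Hom T A), u ;; f = zero T B -> exists! w : Hom T K, w ;; k = u.

Definition IsCokernel A B Q (f : Hom A B) (q : Hom B Q) : Prop :=
  f ;; q = zero A Q /\
  forall T (h : Hom B T), f ;; h = zero A T -> exists! w : Hom Q T, q ;; w = h.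

Lemma zero_l A B D (f : Hom B D) : zero A B ;; f = zero A D.
Proof.
unfold zero; rewrite comp_assoc; f_equal; apply (from_zero_uniq (z := pcat_zero C)).
Qed.

Lemma zero_r A B D (f : Hom A B) : f ;; zero B D = zero A D.
Proof.
unfold zero; rewrite <- comp_assoc; f_equal; apply (to_zero_uniq (z := pcat_zero C)).
Qed.

Lemma toZ_eq T (u v : Hom T Zero) : u = v.
Proof.
transitivity (toZ T); [|symmetry]; apply (to_zero_uniq (z := pcat_zero C)).
Qed.

Lemma copair_uniq A B T (w w' : Hom (Cp A B) T) :
  inl A B ;; w = inl A B ;; w' -> inr A B ;; w = inr A B ;; w' -> w = w'.
Proof. apply cp_uniq. Qed.

Lemma copair_inl A B T (u : Hom A T) (v : Hom B T) : inl A B ;; copair u v = u.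
Proof. apply cp_copair_inl. Qed.

Lemma copair_inr A B T (u : Hom A T) (v : Hom B T) : inr A B ;; copair u v = v.
Proof. apply cp_copair_inr. Qed.

Lemma pr_square A B D (f : Hom A D) (g : Hom B D) : pr1 f g ;; f = pr2 f g ;; g.
Proof. apply pb_square. Qed.

Lemma pair_pr1 A B D (f : Hom A D) (g : Hom B D) T (u : Hom T A) (v : Hom T B)
  (e : u ;; f = v ;; g) : pair e ;; pr1 f g = u.
Proof. apply pb_pair_fst. Qed.

Lemma pair_pr2 A B D (f : Hom A D) (g : Hom B D) T (u : Hom T A) (v : Hom T B)
  (e : u ;; f = v ;; g) : pair e ;; pr2 f g = v.
Proof. apply pb_pair_snd. Qed.

(* The kernel of f as the pullback of f along the zero map into its codomain. *)
Definition Ker A B (f : Hom A B) : C := Pb f (fromZ B).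
Definition ker A B (f : Hom A B) : Hom (Ker f) A := pr1 f (fromZ B).
Definition ker_lift A B (f : Hom A B) T (u : Hom T A) (e : u ;; f = zero T B) :
  Hom T (Ker f) := pair (v := toZ T) e.

Lemma ker_zero A B (f : Hom A B) : ker f ;; f = zero (Ker f) B.
Proof.
transitivity (pr2 f (fromZ B) ;; fromZ B); [apply pr_square|].
unfold zero; f_equal; apply toZ_eq.
Qed.

Definition Prod A B : C := Pb (toZ A) (toZ B).
Definition prodpair A B T (u : Hom T A) (v : Hom T B) : Hom T (Prod A B) :=
  pair (toZ_eq (u ;; toZ A) (v ;; toZ B)).

Definition Regular : Prop :=
  (forall A B (f : Hom A B),
     exists (Q : C) (q : Hom A Q), IsCoequalizer (pr1 f f) (pr2 f f) q) /\
  (forall P A B D (p : Hom P A) (q : Hom P B) (f : Hom A D) (g : Hom B D),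
     IsPullback p q f g -> RegularEpi g -> RegularEpi p).

Record EquivRel E : Type := {
  er_ob : C;
  er1 : Hom er_ob E;
  er2 : Hom er_ob E;
  er_monic : forall T (u v : Hom T er_ob), u ;; er1 = v ;; er1 -> u ;; er2 = v ;; er2 -> u = v;
  er_refl : Hom E er_ob;
  er_refl1 : er_refl ;; er1 = idm E;
  er_refl2 : er_refl ;; er2 = idm E;
  er_sym : exists s : Hom er_ob er_ob, s ;; er1 = er2 /\ s ;; er2 = er1;
  er_trans : exists t : Hom (Pb er2 er1) er_ob,
    t ;; er1 = pr1 er2 er1 ;; er1 /\ t ;; er2 = pr2 er2 er1 ;; er2
}.

Definition Effective E (R : EquivRel E) : Prop :=
  exists (B : C) (f : Hom E B), IsPullback (er1 R) (er2 R) f f.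

Definition BarrExact : Prop :=
  Regular /\ forall E (R : EquivRel E), Effective R.

(* For every v : B' -> B, the change-of-base functor v* : Pt(B) -> Pt(B') of the
   fibration of points is conservative.  Here (A, p, s) and (A', p', s') are
   points over B, h is a morphism between them, and k = v*(h). *)
Definition BournProtomodular : Prop :=
  forall (B B' : C) (v : Hom B' B)
    A (p : Hom A B) (s : Hom B A) A' (p' : Hom A' B) (s' : Hom B A') (h : Hom A A'),
  s ;; p = idm B -> s' ;; p' = idm B -> h ;; p' = p -> s ;; h = s' ->
  forall k : Hom (Pb v p) (Pb v p'),
  k ;; pr1 v p' = pr1 v p -> k ;; pr2 v p' = pr2 v p ;; h ->
  IsIso k -> IsIso h.

Definition SemiAbelian : Prop := BournProtomodular /\ BarrExact.

Definition HuqCommute G H E (g : Hom G E) (h : Hom H E) : Prop :=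
  exists phi : Hom (Prod G H) E,
    prodpair (idm G) (zero G H) ;; phi = g /\
    prodpair (zero H G) (idm H) ;; phi = h.

Lemma smith_l E (R S : EquivRel E) :
  idm (er_ob R) ;; er2 R = er2 R ;; er_refl S ;; er1 S.
Proof. now rewrite comp_assoc, er_refl1, comp_id_l, comp_id_r. Qed.

Lemma smith_r E (R S : EquivRel E) :
  er1 S ;; er_refl R ;; er2 R = idm (er_ob S) ;; er1 S.
Proof. now rewrite comp_assoc, er_refl2, comp_id_l, comp_id_r. Qed.

Definition SmithCommute E (R S : EquivRel E) : Prop :=
  exists Phi : Hom (Pb (er2 R) (er1 S)) E,
    pair (smith_l R S) ;; Phi = er1 R /\ pair (smith_r R S) ;; Phi = er2 S.

Definition normalization E (R : EquivRel E) : Hom (Ker (er2 R)) E := ker (er2 R) ;; er1 R.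

Definition HuqEqSmith : Prop :=
  forall E (R S : EquivRel E),
    HuqCommute (normalization R) (normalization S) -> SmithCommute R S.

Definition Flat B X : C := Ker (copair (idm B) (zero X B)).
Definition flat_j B X : Hom (Flat B X) (Cp B X) := ker (copair (idm B) (zero X B)).

Lemma flat_j_zero B X : flat_j B X ;; copair (idm B) (zero X B) = zero (Flat B X) B.
Proof. apply ker_zero. Qed.

Lemma flat_map_proof B X B' X' (f : Hom B B') (g : Hom X X') :
  flat_j B X ;; cpmap f g ;; copair (idm B') (zero X' B') = zero (Flat B X) B'.
Proof.
rewrite comp_assoc.
replace (cpmap f g ;; copair (idm B') (zero X' B'))
  with (copair (idm B) (zero X B) ;; f).
- now rewrite <- comp_assoc, flat_j_zero, zero_l.
- apply copair_uniq; unfold cpmap; rewrite <- !comp_assoc.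
  + now rewrite !copair_inl, comp_assoc, copair_inl, comp_id_l, comp_id_r.
  + now rewrite !copair_inr, comp_assoc, copair_inr, zero_l, zero_r.
Qed.

Definition flat_map B X B' X' (f : Hom B B') (g : Hom X X') :
  Hom (Flat B X) (Flat B' X') := ker_lift (flat_map_proof f g).

Lemma flat_unit_proof B X : inr B X ;; copair (idm B) (zero X B) = zero X B.
Proof. apply copair_inr. Qed.

Definition flat_unit B X : Hom X (Flat B X) := ker_lift (flat_unit_proof B X).

Lemma flat_mult_proof B X :
  flat_j B (Flat B X) ;; copair (inl B X) (flat_j B X) ;; copair (idm B) (zero X B)
  = zero (Flat B (Flat B X)) B.
Proof.
rewrite comp_assoc, <- (flat_j_zero B (Flat B X)); f_equal.
apply copair_uniq; rewrite <- comp_assoc.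
- now rewrite !copair_inl.
- now rewrite !copair_inr, flat_j_zero.
Qed.

Definition flat_mult B X : Hom (Flat B (Flat B X)) (Flat B X) :=
  ker_lift (flat_mult_proof B X).

(* Algebras for the monad B♭(-), with unit [flat_unit] and multiplication [flat_mult]. *)
Definition IsAction B X (xi : Hom (Flat B X) X) : Prop :=
  flat_unit B X ;; xi = idm X /\
  flat_mult B X ;; xi = flat_map (idm B) xi ;; xi.

Definition conj_action X : Hom (Flat X X) X := flat_j X X ;; copair (idm X) (idm X).

Record CrossedModule : Type := {
  xm_top : C;
  xm_base : C;
  bd : Hom xm_top xm_base;
  act : Hom (Flat xm_base xm_top) xm_top;
  act_action : IsAction act;
  xm_peiffer : flat_map bd (idm xm_top) ;; act = conj_action xm_top;
  xm_equivariant : flat_map (idm xm_base) bd ;; conj_action xm_base = act ;; bd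
}.

Record Butterfly (H G : CrossedModule) : Type := {
  bf_ob : C;
  kappa : Hom (xm_top H) bf_ob;
  rho : Hom bf_ob (xm_base G);
  iota : Hom (xm_top G) bf_ob;
  sigma : Hom bf_ob (xm_base H);
  kappa_sigma : kappa ;; sigma = bd H;
  iota_rho : iota ;; rho = bd G;
  kappa_rho : kappa ;; rho = zero (xm_top H) (xm_base G);
  iota_kernel : IsKernel iota sigma;
  sigma_cokernel : IsCokernel iota sigma;
  kappa_equivariant :
    flat_map (idm bf_ob) kappa ;; conj_action bf_ob
    = flat_map sigma (idm (xm_top H)) ;; act H ;; kappa;
  iota_equivariant :
    flat_map (idm bf_ob) iota ;; conj_action bf_ob
    = flat_map rho (idm (xm_top G)) ;; act G ;; iota
}.

Record ButterflyMor (H G : CrossedModule) (E E' : Butterfly H G) : Type := {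
  bm :> Hom (bf_ob E) (bf_ob E');
  bm_kappa : kappa E ;; bm = kappa E';
  bm_iota : iota E ;; bm = iota E';
  bm_sigma : bm ;; sigma E' = sigma E;
  bm_rho : bm ;; rho E' = rho E
}.

Section Composite.
Variables H G K : CrossedModule.
Variables (E : Butterfly H G) (E' : Butterfly G K).

Definition BfPb : C := Pb (rho E) (sigma E').
Definition bf_r : Hom BfPb (bf_ob E) := pr1 (rho E) (sigma E').
Definition bf_s : Hom BfPb (bf_ob E') := pr2 (rho E) (sigma E').

Lemma comp_middle_proof : iota E ;; rho E = kappa E' ;; sigma E'.
Proof. now rewrite iota_rho, kappa_sigma. Qed.

Lemma comp_kappa_proof :
  kappa E ;; rho E = zero (xm_top H) (bf_ob E') ;; sigma E'.
Proof. now rewrite kappa_rho, zero_l. Qed.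

Lemma comp_iota_proof :
  zero (xm_top K) (bf_ob E) ;; rho E = iota E' ;; sigma E'.
Proof. now rewrite zero_l, (proj1 (iota_kernel E')). Qed.

(* F is the composite of E and E', with [co_q] the chosen cokernel of <iota, kappa'>. *)
Record CompositeOf (F : Butterfly H K) : Type := {
  co_q : Hom BfPb (bf_ob F);
  co_cokernel : IsCokernel (pair comp_middle_proof) co_q;
  co_kappa : kappa F = pair comp_kappa_proof ;; co_q;
  co_rho : co_q ;; rho F = bf_s ;; rho E';
  co_iota : iota F = pair comp_iota_proof ;; co_q;
  co_sigma : co_q ;; sigma F = bf_r ;; sigma E
}.

End Composite.

(* Groupoid structure on the reflexive graph with arrows object G1, objects G0,
   domain d, codomain c and identities e; [gpd_mult] composes x : a -> b with
   y : b -> b' in this order.  The axioms quantify over all proofs of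
   composability, which exist by the other axioms. *)
Record Groupoid (G0 G1 : C) (d c : Hom G1 G0) (e : Hom G0 G1) : Type := {
  gpd_mult : Hom (Pb c d) G1;
  gpd_inv : Hom G1 G1;
  gpd_e_dom : e ;; d = idm G0;
  gpd_e_cod : e ;; c = idm G0;
  gpd_mult_dom : gpd_mult ;; d = pr1 c d ;; d;
  gpd_mult_cod : gpd_mult ;; c = pr2 c d ;; c;
  gpd_unit_l : forall h : d ;; e ;; c = idm G1 ;; d, pair h ;; gpd_mult = idm G1;
  gpd_unit_r : forall h : idm G1 ;; c = c ;; e ;; d, pair h ;; gpd_mult = idm G1;
  gpd_assoc : forall T (x y z : Hom T G1) (hxy : x ;; c = y ;; d) (hyz : y ;; c = z ;; d)
      (h : pair hxy ;; gpd_mult ;; c = z ;; d) (h' : x ;; c = pair hyz ;; gpd_mult ;; d),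
    pair h ;; gpd_mult = pair h' ;; gpd_mult;
  gpd_inv_dom : gpd_inv ;; d = c;
  gpd_inv_cod : gpd_inv ;; c = d;
  gpd_inv_r : forall h : idm G1 ;; c = gpd_inv ;; d, pair h ;; gpd_mult = d ;; e;
  gpd_inv_l : forall h : gpd_inv ;; c = idm G1 ;; d, pair h ;; gpd_mult = c ;; e
}.

(* F is the identity butterfly on G: its object is the semidirect product G1 of
   G and G0, presented by the coequalizer [io_p], and io_g, io_e are the
   canonical morphisms. *)
Record IdentityOf (G : CrossedModule) (F : Butterfly G G) : Type := {
  io_p : Hom (Cp (xm_base G) (xm_top G)) (bf_ob F);
  io_coequalizer : IsCoequalizer (flat_j (xm_base G) (xm_top G))
                     (act G ;; inr (xm_base G) (xm_top G)) io_p;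
  io_e : Hom (xm_base G) (bf_ob F) := inl (xm_base G) (xm_top G) ;; io_p;
  io_g : Hom (xm_top G) (bf_ob F) := inr (xm_base G) (xm_top G) ;; io_p;
  io_c : Hom (bf_ob F) (xm_base G);
  io_d : Hom (bf_ob F) (xm_base G);
  io_g_c : io_g ;; io_c = zero (xm_top G) (xm_base G);
  io_e_c : io_e ;; io_c = idm (xm_base G);
  io_g_d : io_g ;; io_d = bd G;
  io_e_d : io_e ;; io_d = idm (xm_base G);
  io_groupoid : Groupoid io_d io_c io_e;
  io_kappa : kappa F = io_g ;; gpd_inv io_groupoid;
  io_rho : rho F = io_d;
  io_iota : iota F = io_g;
  io_sigma : sigma F = io_c
}.

Lemma hcomp_proof (H G K : CrossedModule) (E F : Butterfly H G) (E' F' : Butterfly G K)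
    (f : ButterflyMor E F) (f' : ButterflyMor E' F') :
  bf_r E E' ;; f ;; rho F = bf_s E E' ;; f' ;; sigma F'.
Proof. rewrite !comp_assoc, bm_rho, bm_sigma; apply pr_square. Qed.

Definition IsHorizontal (H G K : CrossedModule) (E F : Butterfly H G) (E' F' : Butterfly G K)
    (EE' FF' : Butterfly H K) (w : CompositeOf E E' EE') (w' : CompositeOf F F' FF')
    (f : ButterflyMor E F) (f' : ButterflyMor E' F') (ff' : ButterflyMor EE' FF') : Prop :=
  co_q w ;; ff' = pair (hcomp_proof f f') ;; co_q w'.

Section Associator.
Variables H G K L : CrossedModule.
Variables (E : Butterfly H G) (E' : Butterfly G K) (E'' : Butterfly K L).
Variables (EE' : Butterfly H K) (E'E'' : Butterfly G L).
Variables (w : CompositeOf E E' EE') (w' : CompositeOf E' E'' E'E'').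

Definition Triple : C := Pb (bf_s E E' ;; rho E') (sigma E'').
Definition tr12 : Hom Triple (BfPb E E') := pr1 (bf_s E E' ;; rho E') (sigma E'').
Definition tr1 : Hom Triple (bf_ob E) := tr12 ;; bf_r E E'.
Definition tr2 : Hom Triple (bf_ob E') := tr12 ;; bf_s E E'.
Definition tr3 : Hom Triple (bf_ob E'') := pr2 (bf_s E E' ;; rho E') (sigma E'').

Lemma tr_left_proof : tr12 ;; co_q w ;; rho EE' = tr3 ;; sigma E''.
Proof. rewrite comp_assoc, co_rho; apply pr_square. Qed.

Lemma tr23_proof : tr2 ;; rho E' = tr3 ;; sigma E''.
Proof. unfold tr2; rewrite comp_assoc; apply pr_square. Qed.

Definition tr23 : Hom Triple (BfPb E' E'') := pair tr23_proof.

Lemma tr_right_proof : tr1 ;; rho E = tr23 ;; co_q w' ;; sigma E'E''.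
Proof.
assert (h : tr23 ;; bf_r E' E'' = tr2) by apply pair_pr1.
rewrite comp_assoc, co_sigma, <- comp_assoc, h; unfold tr1, tr2.
rewrite !comp_assoc; f_equal; apply pr_square.
Qed.

(* The constraint from (E E') E'' to E (E' E'') induced by the identity of the
   triple pullback, both sides being quotients of it. *)
Definition IsAssociator (L1 R1 : Butterfly H L)
    (wl : CompositeOf EE' E'' L1) (wr : CompositeOf E E'E'' R1)
    (a : ButterflyMor L1 R1) : Prop :=
  pair tr_left_proof ;; co_q wl ;; a = pair tr_right_proof ;; co_q wr.

End Associator.

Section Unitors.
Variables (H G : CrossedModule) (E : Butterfly H G).

Lemma lunit_proof (I : Butterfly H H) (i : IdentityOf I) :
  sigma E ;; io_e i ;; rho I = idm (bf_ob E) ;; sigma E.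
Proof. now rewrite (io_rho i), comp_assoc, io_e_d, comp_id_l, comp_id_r. Qed.

Lemma runit_proof (I : Butterfly G G) (i : IdentityOf I) :
  idm (bf_ob E) ;; rho E = rho E ;; io_e i ;; sigma I.
Proof. now rewrite (io_sigma i), comp_assoc, io_e_c, comp_id_l, comp_id_r. Qed.

(* A unit constraint is an isomorphism, so it is determined by its inverse
   <sigma e, 1> q, resp. <1, rho e> q. *)
Definition IsLeftUnitor (I : Butterfly H H) (i : IdentityOf I) (IE : Butterfly H G)
    (w : CompositeOf I E IE) (l : ButterflyMor IE E) : Prop :=
  pair (lunit_proof i) ;; co_q w ;; l = idm (bf_ob E).

Definition IsRightUnitor (I : Butterfly G G) (i : IdentityOf I) (EI : Butterfly H G)
    (w : CompositeOf E I EI) (r : ButterflyMor EI E) : Prop :=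
  pair (runit_proof i) ;; co_q w ;; r = idm (bf_ob E).

End Unitors.

End Pointed.

(* Bicategories with invertible 2-cells, with given 0-cells, 1-cells and 2-cells.
   All composites are written in diagrammatic order. *)
Record Bicategory (Ob0 : Type) (Hom1 : Ob0 -> Ob0 -> Type)
    (Cell : forall A B : Ob0, Hom1 A B -> Hom1 A B -> Type) : Type := {
  vid : forall A B (f : Hom1 A B), Cell A B f f;
  vcomp : forall A B (f g h : Hom1 A B), Cell A B f g -> Cell A B g h -> Cell A B f h;
  vcomp_id_l : forall A B (f g : Hom1 A B) (a : Cell A B f g), vcomp (vid f) a = a;
  vcomp_id_r : forall A B (f g : Hom1 A B) (a : Cell A B f g), vcomp a (vid g) = a;
  vcomp_assoc : forall A B (f g h k : Hom1 A B)
      (a : Cell A B f g) (b : Cell A B g h) (c : Cell A B h k),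
    vcomp (vcomp a b) c = vcomp a (vcomp b c);
  cell_invertible : forall A B (f g : Hom1 A B) (a : Cell A B f g),
    exists b : Cell A B g f, vcomp a b = vid f /\ vcomp b a = vid g;

  id1 : forall A, Hom1 A A;
  comp1 : forall A B D, Hom1 A B -> Hom1 B D -> Hom1 A D;
  hcomp : forall A B D (f f' : Hom1 A B) (g g' : Hom1 B D),
    Cell A B f f' -> Cell B D g g' -> Cell A D (comp1 f g) (comp1 f' g');
  hcomp_id : forall A B D (f : Hom1 A B) (g : Hom1 B D),
    hcomp (vid f) (vid g) = vid (comp1 f g);
  interchange : forall A B D (f f' f'' : Hom1 A B) (g g' g'' : Hom1 B D)
      (a : Cell A B f f') (a' : Cell A B f' f'') (b : Cell B D g g') (b' : Cell B D g' g''),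
    hcomp (vcomp a a') (vcomp b b') = vcomp (hcomp a b) (hcomp a' b');

  associator : forall A B D E (f : Hom1 A B) (g : Hom1 B D) (h : Hom1 D E),
    Cell A E (comp1 (comp1 f g) h) (comp1 f (comp1 g h));
  associator_natural : forall A B D E (f f' : Hom1 A B) (g g' : Hom1 B D) (h h' : Hom1 D E)
      (a : Cell A B f f') (b : Cell B D g g') (c : Cell D E h h'),
    vcomp (hcomp (hcomp a b) c) (associator f' g' h')
    = vcomp (associator f g h) (hcomp a (hcomp b c));
  left_unitor : forall A B (f : Hom1 A B), Cell A B (comp1 (id1 A) f) f;
  left_unitor_natural : forall A B (f f' : Hom1 A B) (a : Cell A B f f'),
    vcomp (hcomp (vid (id1 A)) a) (left_unitor f') = vcomp (left_unitor f) a;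
  right_unitor : forall A B (f : Hom1 A B), Cell A B (comp1 f (id1 B)) f;
  right_unitor_natural : forall A B (f f' : Hom1 A B) (a : Cell A B f f'),
    vcomp (hcomp a (vid (id1 B))) (right_unitor f') = vcomp (right_unitor f) a;

  pentagon : forall A B D E F (f : Hom1 A B) (g : Hom1 B D) (h : Hom1 D E) (k : Hom1 E F),
    vcomp (associator (comp1 f g) h k) (associator f g (comp1 h k))
    = vcomp (vcomp (hcomp (associator f g h) (vid k)) (associator f (comp1 g h) k))
            (hcomp (vid f) (associator g h k));
  triangle : forall A B D (f : Hom1 A B) (g : Hom1 B D),
    vcomp (associator f (id1 B) g) (hcomp (vid f) (left_unitor g))
    = hcomp (right_unitor f) (vid g)
}.

(* Main.v *)
From Corelib Require Import ssreflect.
From Stdlib Require Import IndefiniteDescription ProofIrrelevance.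
Require Import Defs.

Set Implicit Arguments.
Unset Strict Implicit.
Unset Printing Implicit Defensive.

(** A morphism [u] from an arbitrary object [T] is treated as a generalized element
    of its codomain, a mono [n] as a subobject to which elements may belong
    ([Fac u n]), and a regular epimorphism as a cover, after which elements may be
    lifted.  In this language the proof runs as for groups, as follows.

    Protomodularity amounts to an induction principle, [point_ind]: an element that
    ranges over a split epimorphism belongs to a subobject as soon as it does so on
    the section and on the kernel.  It makes relations difunctional, regular
    epimorphisms cokernels of their kernels, and gives the short five lemma, hence
    the invertibility of morphisms of butterflies.  Together with exactness it
    yields, for each reflexive pair, a quotient whose kernel pair is explicit on
    covers ([reflexive_quotient]).  Two applications of this quotient carry the
    construction of 1-cells: every action has a semidirect product
    ([semidirect]), and every subobject stable under conjugation is normal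
    ([conj_stable_normal]).

    For the composite of [E : H -> G] and [E' : G -> K], the two equivariance
    conditions on the side of [G] say that the pullback of [E] and [E'] over the
    base of [G] acts on the top object of [G] by conjugation through
    [(iota, kappa')].  Hence this subobject is normal and is the kernel of its
    cokernel, from which the exactness of [iota, sigma] for the composite follows.
    Equivariance descends to the cokernel because compatibility with an action is
    the extension of a pair of morphisms to a semidirect product, and semidirect
    products are pulled back from the base ([Compat_descend]).

    For the identity on [G], let [G1] be the semidirect product.  The
    Peiffer condition only composes arrows [y] of [G1] with arrows [h] into the zero
    object.  This composition can be undone by division, which supplies the inverses
    of the arrows into zero; they are exactly the arrows out of zero
    ([star_inverse_kernel]), and division also shows that they commute with the
    arrows into zero in the sense of Huq.  The Huq = Smith condition turns this into
    a partial operation [x y^-1 z], whose values at an identity [y] compose all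
    composable arrows.  A unital composition on a reflexive graph is automatically a
    groupoid ([unital_groupoid]), and the two equivariance conditions of the
    identity butterfly hold because conjugates are composites in this groupoid.

    Finally, an element of a composite butterfly is, on a cover, the class of a pair
    [(x, y)] ([Cls]), and morphisms are determined by their effect on such classes.
    Horizontal composition sends [(x, y)] to [(x f, y f')], the associator sends
    [((x, y), z)] to [(x, (y, z))], and the inverse unit constraints send [x] to its
    pair with an identity arrow.  The coherence axioms compare such formulas. *)

(** * Calculus of composites and elements *)

Lemma comp_congr_r (C : Category) (A B D : C) (f : Hom A B) (g : Hom B D) (h : Hom A D) :
  f ;; g = h -> forall T (x : Hom D T), f ;; (g ;; x) = h ;; x.
Proof. by move=> <- T x; rewrite comp_assoc. Qed.

Section Elements.
Context (C : PointedCategory).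
Implicit Types A B D E T X Y : C.

Definition fstp A B : Hom (Prod A B) A := pr1 _ _.
Definition sndp A B : Hom (Prod A B) B := pr2 _ _.

Lemma pair_fstp A B T (u : Hom T A) (v : Hom T B) : prodpair u v ;; fstp A B = u.
Proof. exact: pair_pr1. Qed.

Lemma pair_sndp A B T (u : Hom T A) (v : Hom T B) : prodpair u v ;; sndp A B = v.
Proof. exact: pair_pr2. Qed.

Lemma comp_fromZ T D (f : Hom T (Zero C)) : f ;; fromZ D = zero T D.
Proof. by rewrite /zero; f_equal; exact: toZ_eq. Qed.

Lemma pb_ext A B D (f : Hom A D) (g : Hom B D) T (w w' : Hom T (Pb f g)) :
  w ;; pr1 f g = w' ;; pr1 f g -> w ;; pr2 f g = w' ;; pr2 f g -> w = w'.
Proof. exact: pb_uniq. Qed.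

Lemma prod_ext A B T (w w' : Hom T (Prod A B)) :
  w ;; fstp A B = w' ;; fstp A B -> w ;; sndp A B = w' ;; sndp A B -> w = w'.
Proof. exact: pb_uniq. Qed.

(* The primed variants let the projection rules fire in the middle of composites
   that are associated to the right. *)
Definition pair_pr1' A B D f g T u v e E x :=
  @comp_congr_r _ _ _ _ _ _ _ (@pair_pr1 C A B D f g T u v e) E x.
Definition pair_pr2' A B D f g T u v e E x :=
  @comp_congr_r _ _ _ _ _ _ _ (@pair_pr2 C A B D f g T u v e) E x.
Definition pair_fstp' A B T u v E x :=
  @comp_congr_r _ _ _ _ _ _ _ (@pair_fstp A B T u v) E x.
Definition pair_sndp' A B T u v E x :=
  @comp_congr_r _ _ _ _ _ _ _ (@pair_sndp A B T u v) E x.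
Definition copair_inl' A B T u v E x :=
  @comp_congr_r _ _ _ _ _ _ _ (@copair_inl C A B T u v) E x.
Definition copair_inr' A B T u v E x :=
  @comp_congr_r _ _ _ _ _ _ _ (@copair_inr C A B T u v) E x.

End Elements.

Global Hint Rewrite comp_assoc comp_id_l comp_id_r zero_l zero_r
  pair_pr1 pair_pr2 pair_fstp pair_sndp copair_inl copair_inr
  pair_pr1' pair_pr2' pair_fstp' pair_sndp' copair_inl' copair_inr' : cat.

Ltac cat := autorewrite with cat.
Ltac catd := cat; try reflexivity; try eassumption.

Section Factor.
Context (C : PointedCategory).
Implicit Types A B D E T X Y : C.

Definition Mono A B (m : Hom A B) : Prop :=
  forall T (u v : Hom T A), u ;; m = v ;; m -> u = v.

Definition Epi A B (q : Hom A B) : Prop :=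
  forall T (u v : Hom B T), q ;; u = q ;; v -> u = v.

(** [u], read as a generalized element of [E], belongs to the subobject [n]. *)
Definition Fac T N E (u : Hom T E) (n : Hom N E) : Prop := exists x, x ;; n = u.

Lemma Fac_pre S T N E (t : Hom S T) (u : Hom T E) (n : Hom N E) :
  Fac u n -> Fac (t ;; u) n.
Proof. by case=> x <-; exists (t ;; x); catd. Qed.

Lemma mono_all_iso A B (m : Hom A B) : Mono m -> Fac (idm B) m -> IsIso m.
Proof. by move=> mm [x xm]; exists x; split=> //; apply: mm; cat; rewrite xm; catd. Qed.

Lemma kernel_mono K A B (k : Hom K A) (f : Hom A B) : IsKernel k f -> Mono k.
Proof.
move=> [k0 U] T u v e.
have [w [_ W]] : exists! w, w ;; k = v ;; k by apply: U; cat; rewrite k0; catd.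
by rewrite -(W u e); apply: W.
Qed.

Lemma kernel_fac K A B (k : Hom K A) (f : Hom A B) T (u : Hom T A) :
  IsKernel k f -> u ;; f = zero T B -> Fac u k.
Proof. by move=> [k0 U] /U [w [e _]]; exists w. Qed.

Lemma kernel_intro K A B (k : Hom K A) (f : Hom A B) :
  k ;; f = zero K B -> Mono k ->
  (forall T (u : Hom T A), u ;; f = zero T B -> Fac u k) -> IsKernel k f.
Proof.
move=> k0 mk U; split=> // T u /U [w e]; exists w; split=> // w' e'.
by apply: mk; rewrite e e'.
Qed.

Lemma coker_lift A B Q (f : Hom A B) (q : Hom B Q) T (h : Hom B T) :
  IsCokernel f q -> f ;; h = zero A T -> exists w, q ;; w = h.
Proof. by move=> [q0 U] /U [w [e _]]; exists w. Qed.

Lemma pr1_mono A B D (f : Hom A D) (g : Hom B D) : Mono g -> Mono (pr1 f g).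
Proof.
move=> mg T u v e; apply: pb_ext => //; apply: mg.
by rewrite !comp_assoc -!pr_square -!comp_assoc e.
Qed.

Lemma ker_kernel A B (f : Hom A B) : IsKernel (ker f) f.
Proof.
apply: kernel_intro; first exact: ker_zero.
  by apply: pr1_mono => T u v _; exact: toZ_eq.
by move=> T u u0; exists (ker_lift u0); exact: pair_pr1.
Qed.

Lemma diag_mono A : Mono (prodpair (idm A) (idm A)).
Proof. by move=> T u v /(f_equal (fun z => z ;; fstp A A)); cat. Qed.

Lemma Fac_diag T A (u v : Hom T A) :
  Fac (prodpair u v) (prodpair (idm A) (idm A)) <-> u = v.
Proof.
split; last by move=> ->; exists v; apply: prod_ext; catd.
case=> x e; move: (f_equal (fun z => z ;; fstp A A) e) (f_equal (fun z => z ;; sndp A A) e).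
by cat => -> ->.
Qed.

End Factor.

(** * Protomodularity *)

Section Protomodular.
Context (C : PointedCategory) (proto : BournProtomodular C).
Implicit Types A B D E T X Y : C.

(** The induction principle of protomodularity.  The preimage [M] of [n] under [g]
    contains the section, so it is a point over [B]; the last hypothesis says that
    change of base along [v] inverts the inclusion of [M] into [A], and change of
    base reflects isomorphisms. *)
Lemma point_ind A B B' (p : Hom A B) (s : Hom B A) (v : Hom B' B)
    N E (g : Hom A E) (n : Hom N E) :
  s ;; p = idm B -> Mono n -> Fac (s ;; g) n ->
  (forall T (u : Hom T A) (t : Hom T B'), t ;; v = u ;; p -> Fac (u ;; g) n) ->
  Fac g n.
Proof.
move=> sp mn [y yn] H.
pose m := pr1 g n.
have mm : Mono m by exact: pr1_mono.
have facm T (u : Hom T A) : Fac (u ;; g) n -> Fac u m.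
  by case=> x e; exists (pair (eq_sym e)); exact: pair_pr1.
have [z zm] : Fac s m by apply: facm; exists y.
have [x xm] : Fac (pr2 v p) m by apply: facm; apply: H; exact: pr_square.
have kp : pr1 v (m ;; p) ;; v = pr2 v (m ;; p) ;; m ;; p.
  by rewrite pr_square comp_assoc.
have ik : pr1 v p ;; v = x ;; (m ;; p) by rewrite -comp_assoc xm pr_square.
have [w [_ w1]] : IsIso m.
  have zmp : z ;; (m ;; p) = idm B by rewrite -comp_assoc zm.
  refine (@proto _ _ v _ _ _ _ _ _ _ zmp sp (eq_refl _) zm (pair kp) (pair_pr1 _) (pair_pr2 _) _).
  exists (pair ik); split; apply: pb_ext; catd.
  by apply: mm; cat; rewrite xm; catd.
exists (w ;; pr2 g n).
by rewrite comp_assoc -pr_square -comp_assoc w1 comp_id_l.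
Qed.

Lemma kernel_ind A B K (p : Hom A B) (s : Hom B A) (k : Hom K A)
    N E (g : Hom A E) (n : Hom N E) :
  s ;; p = idm B -> IsKernel k p -> Mono n -> Fac (s ;; g) n -> Fac (k ;; g) n -> Fac g n.
Proof.
move=> sp kk mn Fs Fk; apply: (point_ind (v := fromZ B) sp mn Fs) => T u t e.
have u0 : u ;; p = zero T B by rewrite -e comp_fromZ.
by have [x <-] := kernel_fac kk u0; cat; apply: Fac_pre.
Qed.

(** Equality of [f] and [g] is membership of [(f, g)] in the diagonal.  Quantifying
    over the elements [u] of the kernel, instead of taking a kernel morphism, spares
    the construction of a kernel of [p] at each use. *)
Lemma kernel_epic_elt A B (p : Hom A B) (s : Hom B A) E (f g : Hom A E) :
  s ;; p = idm B -> s ;; f = s ;; g ->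
  (forall T (u : Hom T A), u ;; p = zero T B -> u ;; f = u ;; g) -> f = g.
Proof.
move=> sp es H; apply/Fac_diag.
apply: (point_ind (v := fromZ B) sp (@diag_mono _ _)).
  by exists (s ;; f); apply: prod_ext; catd.
move=> T u t e; exists (u ;; f); apply: prod_ext; cat=> //; apply: H.
by rewrite -e comp_fromZ.
Qed.

Lemma prod_epic A B E (f g : Hom (Prod A B) E) :
  prodpair (idm A) (zero A B) ;; f = prodpair (idm A) (zero A B) ;; g ->
  prodpair (zero B A) (idm B) ;; f = prodpair (zero B A) (idm B) ;; g -> f = g.
Proof.
move=> e1 e2; apply: (@kernel_epic_elt _ _ (sndp A B) (prodpair (zero B A) (idm B))); catd.
move=> T u u0.
have -> : u = u ;; fstp A B ;; prodpair (idm A) (zero A B) by apply: prod_ext; catd.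
by cat; rewrite e1.
Qed.

(** The injections [e1 = (1, p s')] and [e2 = (p' s, 1)] are jointly extremal epic:
    [e2] is a section of the second projection, and the pullback of that
    projection along [s'] is [e1]. *)
Lemma points_ind A A' B (p : Hom A B) (s : Hom B A) (p' : Hom A' B) (s' : Hom B A')
    (e1 : Hom A (Pb p p')) (e2 : Hom A' (Pb p p')) N E (g : Hom (Pb p p') E) (n : Hom N E) :
  s ;; p = idm B -> s' ;; p' = idm B ->
  e1 ;; pr1 p p' = idm A -> e1 ;; pr2 p p' = p ;; s' ->
  e2 ;; pr1 p p' = p' ;; s -> e2 ;; pr2 p p' = idm A' ->
  Mono n -> Fac (e1 ;; g) n -> Fac (e2 ;; g) n -> Fac g n.
Proof.
move=> sp sp' e11 e12 e21 e22 mn F1 F2.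
apply: (point_ind (v := s') e22 mn F2) => T u t e.
have -> : u = u ;; pr1 p p' ;; e1.
  apply: pb_ext; cat; rewrite ?e11 ?e12; catd.
  have et : u ;; (pr1 p p' ;; p) = t by rewrite pr_square -comp_assoc -e comp_assoc sp' comp_id_r.
  by rewrite -e -et !comp_assoc.
by rewrite comp_assoc; apply: Fac_pre.
Qed.

Lemma points_epic A A' B (p : Hom A B) (s : Hom B A) (p' : Hom A' B) (s' : Hom B A')
    (e1 : Hom A (Pb p p')) (e2 : Hom A' (Pb p p')) E (f g : Hom (Pb p p') E) :
  s ;; p = idm B -> s' ;; p' = idm B ->
  e1 ;; pr1 p p' = idm A -> e1 ;; pr2 p p' = p ;; s' ->
  e2 ;; pr1 p p' = p' ;; s -> e2 ;; pr2 p p' = idm A' ->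
  e1 ;; f = e1 ;; g -> e2 ;; f = e2 ;; g -> f = g.
Proof.
move=> sp sp' e11 e12 e21 e22 E1 E2; apply/Fac_diag.
apply: (points_ind sp sp' e11 e12 e21 e22 (@diag_mono _ _));
  [exists (e1 ;; f)|exists (e2 ;; f)]; by apply: prod_ext; catd.
Qed.

(** The split short five lemma is conservativity of change of base along the zero
    morphism into [B]; the two last hypotheses are bijectivity on elements of the
    kernels. *)
Lemma split_five A A' B (p : Hom A B) (s : Hom B A) (p' : Hom A' B) (s' : Hom B A')
    (h : Hom A A') :
  s ;; p = idm B -> s' ;; p' = idm B -> h ;; p' = p -> s ;; h = s' ->
  (forall T (u : Hom T A'), u ;; p' = zero T B -> exists w, w ;; p = zero T B /\ w ;; h = u) ->
  (forall T (u v : Hom T A), u ;; p = zero T B -> v ;; p = zero T B ->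
     u ;; h = v ;; h -> u = v) ->
  IsIso h.
Proof.
move=> sp sp' hp sh surj inj.
have kp : pr1 (fromZ B) p ;; fromZ B = pr2 (fromZ B) p ;; h ;; p'.
  by rewrite pr_square comp_assoc hp.
have [|w [w0 wh]] := surj _ (pr2 (fromZ B) p') _; first by rewrite -pr_square comp_fromZ.
have ip : pr1 (fromZ B) p' ;; fromZ B = w ;; p by rewrite comp_fromZ w0.
apply: (@proto _ _ (fromZ B) _ _ _ _ _ _ _ sp sp' hp sh (pair kp)).
- exact: pair_pr1.
- exact: pair_pr2.
- exists (pair ip); split; apply: pb_ext; try exact: toZ_eq; cat; last by rewrite wh.
  apply: inj; cat; first by rewrite w0; catd.
    by rewrite -pr_square comp_fromZ.
  by rewrite wh; cat.
Qed.

(** The kernel pair of [f] is a point over [A], split by the diagonal, and its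
    kernel consists of elements of the kernel of [f]; so both projections agree. *)
Lemma mono_of_trivial_kernel A B (f : Hom A B) :
  (forall T (u : Hom T A), u ;; f = zero T B -> u = zero T A) -> Mono f.
Proof.
move=> H.
have sd : idm A ;; f = idm A ;; f by [].
have E : pr1 f f = pr2 f f.
  apply: (@kernel_epic_elt _ _ (pr1 f f) (pair sd)); catd => T u u0.
  by rewrite u0; symmetry; apply: H; rewrite comp_assoc -pr_square -comp_assoc u0; catd.
move=> T u v e.
by transitivity (pair e ;; pr1 f f); [rewrite pair_pr1 | rewrite E pair_pr2].
Qed.

Section Difunctional.
Context (X R : C) (r1 r2 : Hom R X).

Definition Related T (x y : Hom T X) : Prop := exists u, u ;; r1 = x /\ u ;; r2 = y.

Hypothesis jmono : forall T (u v : Hom T R), u ;; r1 = v ;; r1 -> u ;; r2 = v ;; r2 -> u = v.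

(** The quadruples with [x R y], [z R y] and [z R w] form a pullback of two points
    over [R]: the triples [(x, y, z)], split by [x = z], and the triples
    [(y, z, w)], split by [w = y].  On the two injections [x R w] is one of the
    hypotheses, so it holds throughout. *)
Lemma difunctional T (x y z w : Hom T X) :
  Related x y -> Related z y -> Related z w -> Related x w.
Proof.
move=> [a [ax ay]] [b [bz b_y]] [c [cz cw]].
pose p := pr2 r2 r2; pose p' := pr1 r1 r1.
have d2 : idm R ;; r2 = idm R ;; r2 by [].
have d1 : idm R ;; r1 = idm R ;; r1 by [].
have q1 : idm _ ;; p = p ;; pair d1 ;; p' by rewrite /p'; catd.
have q2 : p' ;; pair d2 ;; p = idm _ ;; p' by rewrite /p; catd.
have mn : Mono (prodpair r1 r2).
  move=> S u v e; apply: jmono;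
    [move: (f_equal (fun z => z ;; fstp X X) e)|move: (f_equal (fun z => z ;; sndp X X) e)];
    by cat.
pose g := prodpair (pr1 p p' ;; (pr1 r2 r2 ;; r1)) (pr2 p p' ;; (pr2 r1 r1 ;; r2)).
have [f ef] : Fac g (prodpair r1 r2).
{ apply: (points_ind (s := pair d2) (s' := pair d1) (e1 := pair q1) (e2 := pair q2));
    rewrite /p /p'; catd.
  - exists (pr1 r2 r2); apply: prod_ext; rewrite /g /p'; catd.
    by rewrite -pr_square.
  - exists (pr2 r1 r1); apply: prod_ext; rewrite /g /p; catd.
    by rewrite -pr_square. }
have ab : a ;; r2 = b ;; r2 by rewrite ay b_y.
have bc : b ;; r1 = c ;; r1 by rewrite bz cz.
have tt : pair ab ;; p = pair bc ;; p' by rewrite /p /p'; catd.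
exists (pair tt ;; f); split.
- move: (f_equal (fun z => pair tt ;; z ;; fstp X X) ef); rewrite /g; cat => ->.
  by rewrite ax.
- move: (f_equal (fun z => pair tt ;; z ;; sndp X X) ef); rewrite /g; cat => ->.
  by rewrite cw.
Qed.

End Difunctional.

End Protomodular.

(** * Regular epimorphisms and exactness *)

Section SemiAbelian.
Context (C : PointedCategory) (sa : SemiAbelian C).
Implicit Types A B D E K T X Y : C.

Let proto : BournProtomodular C := proj1 sa.

Lemma regepi_factor A B D (q : Hom A B) (f : Hom A D) :
  RegularEpi q ->
  (forall T (u v : Hom T A), u ;; q = v ;; q -> u ;; f = v ;; f) -> exists g, q ;; g = f.
Proof.
by move=> [R [a [b [e U]]]] H; have [g [eg _]] := U _ f (H _ _ _ e); exists g.
Qed.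

Lemma regepi_epi A B (q : Hom A B) : RegularEpi q -> Epi q.
Proof.
move=> [R [a [b [e U]]]] T u v euv.
have [|w [_ W]] := U _ (q ;; v); first by rewrite -!comp_assoc e.
by rewrite -(W u euv); apply: W.
Qed.

(** Descent: a cover is a coequalizer, and a mono cancels its parallel pair. *)
Lemma cover_fac S T N E (c : Hom S T) (t : Hom T E) (n : Hom N E) :
  RegularEpi c -> Mono n -> Fac (c ;; t) n -> Fac t n.
Proof.
move=> rc mn [z e].
have [|g eg] := @regepi_factor _ _ _ c z rc.
  by move=> V u v euv; apply: mn; cat; rewrite e -!comp_assoc euv.
by exists g; apply: (regepi_epi rc); rewrite -comp_assoc eg.
Qed.

Lemma regepi_pr1 A B D (f : Hom A D) (g : Hom B D) : RegularEpi g -> RegularEpi (pr1 f g).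
Proof.
apply: (proj2 (proj1 (proj2 sa))); split; first exact: pr_square.
move=> T u v e; exists (pair e); split; first by catd.
by move=> w [e1 e2]; apply: pb_ext; catd.
Qed.

Lemma regepi_pr2 A B D (f : Hom A D) (g : Hom B D) : RegularEpi f -> RegularEpi (pr2 f g).
Proof.
apply: (proj2 (proj1 (proj2 sa))); split; first exact: (eq_sym (pr_square _ _)).
move=> T u v e; exists (pair (eq_sym e)); split; first by catd.
by move=> w [e1 e2]; apply: pb_ext; catd.
Qed.

(** Local surjectivity: the cover is the pullback of [q] along the element. *)
Lemma cover_lift A B (q : Hom A B) T (u : Hom T B) :
  RegularEpi q -> exists S (c : Hom S T) (v : Hom S A), RegularEpi c /\ c ;; u = v ;; q.
Proof.
move=> rq; exists (Pb u q), (pr1 u q), (pr2 u q); split; last exact: pr_square.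
exact: regepi_pr1.
Qed.

(** The quotient [e] by the kernel pair of [f] leaves a mono [m], since two elements
    identified by [m] lift, on a cover, to a pair in the kernel pair of [f]. *)
Lemma image A B (f : Hom A B) :
  exists I (e : Hom A I) (m : Hom I B), RegularEpi e /\ Mono m /\ e ;; m = f.
Proof.
have [I [e ce]] := proj1 (proj1 (proj2 sa)) _ _ f.
have re : RegularEpi e by exists (Pb f f), (pr1 f f), (pr2 f f).
have [m [em _]] := proj2 ce _ f (pr_square f f).
exists I, e, m; split=> //; split=> // T u v euv.
have [S [c [x [rc ex]]]] := cover_lift u re.
have [S' [c' [y [rc' ey]]]] := cover_lift (c ;; v) re.
have e12 : c' ;; x ;; f = y ;; f.
  by rewrite -em -!comp_assoc -ey !comp_assoc -euv (comp_congr_r ex) !comp_assoc.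
apply: (regepi_epi rc); apply: (regepi_epi rc').
rewrite ey ex -comp_assoc.
transitivity (pair e12 ;; pr1 f f ;; e); first by catd.
by rewrite comp_assoc (proj1 ce); catd.
Qed.

Lemma extremal_regepi A B (f : Hom A B) :
  (forall M (m : Hom M B), Mono m -> Fac f m -> Fac (idm B) m) -> RegularEpi f.
Proof.
move=> H; have [I [e [m [[R [a [b [ab U]]]] [mm em]]]]] := image f.
have [n [mn nm]] : IsIso m.
  by apply: mono_all_iso => //; apply: H => //; exists e.
exists R, a, b; split; first by rewrite -em -!comp_assoc ab.
move=> T h /U [w [ew W]]; exists (n ;; w); split.
  by rewrite -em; cat; rewrite -(comp_assoc m) mn; catd.
move=> w' ew'; have <- : m ;; w' = w.
  by symmetry; apply: W; rewrite -comp_assoc em.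
by rewrite -comp_assoc nm; catd.
Qed.

Lemma regepi_comp A B D (f : Hom A B) (g : Hom B D) :
  RegularEpi f -> RegularEpi g -> RegularEpi (f ;; g).
Proof.
move=> rf rg; apply: extremal_regepi => M m mm F.
by apply: (cover_fac rg) => //; apply: (cover_fac rf) => //; rewrite comp_id_r.
Qed.

Lemma regepi_cancel A B D (f : Hom A B) (g : Hom B D) :
  RegularEpi (f ;; g) -> RegularEpi g.
Proof.
move=> r; apply: extremal_regepi => M m mm F.
by apply: (cover_fac r) => //; rewrite comp_id_r; apply: Fac_pre.
Qed.

Lemma split_regepi A B (p : Hom A B) (s : Hom B A) : s ;; p = idm B -> RegularEpi p.
Proof. by move=> sp; apply: extremal_regepi => M m mm F; rewrite -sp; apply: Fac_pre. Qed.

(** The kernel pair of [q] is generated by the diagonal and by the kernel of [q], as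
    in [mono_of_trivial_kernel]; so a morphism that kills the kernel factors. *)
Lemma regepi_kernel_factor A B D (q : Hom A B) (f : Hom A D) :
  RegularEpi q -> (forall T (u : Hom T A), u ;; q = zero T B -> u ;; f = zero T D) ->
  exists g, q ;; g = f.
Proof.
move=> rq H; apply: (regepi_factor rq) => T u v e.
have sd : idm A ;; q = idm A ;; q by [].
have E : pr1 q q ;; f = pr2 q q ;; f.
  apply: (@kernel_epic_elt _ proto _ _ (pr1 q q) (pair sd)); catd => S w w0.
  rewrite -!comp_assoc w0; cat; symmetry; rewrite -comp_assoc; apply: H.
  by rewrite comp_assoc -pr_square -comp_assoc w0; catd.
by transitivity (pair e ;; pr1 q q ;; f); [|rewrite comp_assoc E]; catd.
Qed.

Lemma regepi_cokernel K A B (k : Hom K A) (q : Hom A B) :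
  RegularEpi q -> IsKernel k q -> IsCokernel k q.
Proof.
move=> rq kk; split; first exact: (proj1 kk).
move=> T h h0.
have [|w ew] := @regepi_kernel_factor _ _ _ q h rq.
  by move=> S u /(kernel_fac kk) [x <-]; cat; rewrite h0; catd.
by exists w; split=> // w' ew'; apply: (regepi_epi rq); rewrite ew.
Qed.

Lemma cokernel_regepi A B Q (f : Hom A B) (q : Hom B Q) : IsCokernel f q -> RegularEpi q.
Proof.
move=> [q0 U]; exists A, f, (zero A B); split; first by cat.
by move=> T h; cat; apply: U.
Qed.

(** Surjectivity is checked on the pairs of an element of [E] and an element of [E']
    with the same image in [H].  They form a point over [E], split by [(1, f)], on
    which the second component belongs to [f]; and they cover [E']. *)
Lemma short_five G E E' H (i : Hom G E) (i' : Hom G E') (s : Hom E H) (s' : Hom E' H)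
    (f : Hom E E') :
  IsKernel i s -> IsKernel i' s' -> RegularEpi s -> i ;; f = i' -> f ;; s' = s -> IsIso f.
Proof.
move=> ki ki' rs fi fs.
have mf : Mono f.
  apply: (mono_of_trivial_kernel proto) => T u u0.
  have [|x ex] := kernel_fac (u := u) ki; first by rewrite -fs -comp_assoc u0; catd.
  rewrite -ex; suff -> : x = zero T G by cat.
  by apply: (kernel_mono ki'); rewrite -fi -comp_assoc ex u0; catd.
apply: mono_all_iso => //.
have ds : idm E ;; (f ;; s') = f ;; s' by cat.
have F : Fac (pr2 (f ;; s') s') f.
{ apply: (kernel_ind proto (p := pr1 (f ;; s') s') (s := pair ds)
            (k := ker (pr1 (f ;; s') s'))) => //; first by catd.
  - exact: ker_kernel.
  - by exists (idm E); catd.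
  - set k := ker _.
    have [|x <-] := kernel_fac (u := k ;; pr2 (f ;; s') s') ki'.
      by rewrite comp_assoc -pr_square -comp_assoc ker_zero; catd.
    by exists (x ;; i); rewrite comp_assoc fi. }
apply: (cover_fac (c := pr2 (f ;; s') s')) => //; last by rewrite comp_id_r.
by apply: regepi_pr2; rewrite fs.
Qed.

(** The image of a reflexive pair is a reflexive, hence by difunctionality an
    equivalence, relation; exactness makes it the kernel pair of its quotient.
    The cover [c] is needed because an image is only covered by its source. *)
Lemma reflexive_quotient W X (a b : Hom W X) (r : Hom X W) :
  r ;; a = idm X -> r ;; b = idm X ->
  exists Q (q : Hom X Q), RegularEpi q /\ forall T (x y : Hom T X), x ;; q = y ;; q <->
    exists S (c : Hom S T) (w : Hom S W), RegularEpi c /\ c ;; x = w ;; a /\ c ;; y = w ;; b.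
Proof.
move=> ra rb.
have [R [e [m [re [mm em]]]]] := image (prodpair a b).
pose r1 := m ;; fstp X X; pose r2 := m ;; sndp X X.
have er1 : e ;; r1 = a by rewrite /r1 -comp_assoc em pair_fstp.
have er2 : e ;; r2 = b by rewrite /r2 -comp_assoc em pair_sndp.
have jm T (u v : Hom T R) : u ;; r1 = v ;; r1 -> u ;; r2 = v ;; r2 -> u = v.
  by rewrite /r1 /r2 -!comp_assoc => e1 e2; apply: mm; apply: prod_ext.
clearbody r1 r2.
have rel T (u : Hom T R) : Related r1 r2 (u ;; r1) (u ;; r2) by exists u.
have refl T (x : Hom T X) : Related r1 r2 x x.
  by exists (x ;; r ;; e); rewrite !comp_assoc er1 er2 ra rb; catd.
have dif := difunctional proto jm.
have [s [s1 s2]] : Related r1 r2 r2 r1.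
  apply: dif (refl _ _) _ (refl _ _).
  by move: (rel _ (idm R)); cat.
have [t [t1 t2]] : Related r1 r2 (pr1 r2 r1 ;; r1) (pr2 r2 r1 ;; r2).
  apply: dif (rel _ _) _ (rel _ _).
  by rewrite -pr_square; apply: refl.
pose Req := Build_EquivRel (C := C) (er_ob := R) (er1 := r1) (er2 := r2) (er_refl := r ;; e) jm
  (ltac:(by rewrite comp_assoc er1)) (ltac:(by rewrite comp_assoc er2))
  (ex_intro _ s (conj s1 s2)) (ex_intro _ t (conj t1 t2)).
have [B [f [/= rf U]]] := proj2 (proj2 sa) _ Req.
have [Q [q cq]] := proj1 (proj1 (proj2 sa)) _ _ f.
have rq : RegularEpi q by exists (Pb f f), (pr1 f f), (pr2 f f).
have [g [qg _]] := proj2 cq _ f (pr_square f f).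
exists Q, q; split=> // T x y; split.
- move=> exy; have exyf : x ;; f = y ;; f by rewrite -qg -!comp_assoc exy.
  have [u [[u1 u2] _]] := U _ _ _ exyf.
  have [S [c [w [rc ew]]]] := cover_lift u re.
  by exists S, c, w; split=> //; rewrite -u1 -u2 -!comp_assoc ew !comp_assoc er1 er2.
- move=> [S [c [w [rc [ex ey]]]]]; apply: (regepi_epi rc).
  have ef : a ;; f = b ;; f by rewrite -er1 -er2 !comp_assoc rf.
  have eq : a ;; q = b ;; q.
    by transitivity (pair ef ;; pr1 f f ;; q); [|rewrite comp_assoc (proj1 cq)]; catd.
  by rewrite -!comp_assoc ex ey !comp_assoc eq.
Qed.

End SemiAbelian.

(** * Actions and split extensions *)

Section Actions.
Context (C : PointedCategory).
Implicit Types A B D E K T X Y : C.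

(** For groups, this says [b (t . x) = a t * b x * (a t)^-1], where [t . x] is the
    action [xi]: conjugation by [a] restricts along [b] to [xi]. *)
Definition Compat A X T (xi : Hom (Flat A X) X) (a : Hom A T) (b : Hom X T) : Prop :=
  flat_j A X ;; copair a b = xi ;; b.

(** A split extension of [B] by [X] that induces the action [xi], that is, a
    semidirect product of [X] and [B] along [xi]. *)
Record SplitExt B X A (xi : Hom (Flat B X) X) (p : Hom A B) (s : Hom B A) (k : Hom X A) : Prop :=
  { se_section : s ;; p = idm B;
    se_kernel : IsKernel k p;
    se_compat : Compat xi s k }.

Lemma flat_j_kernel A X : IsKernel (flat_j A X) (copair (idm A) (zero X A)).
Proof. exact: ker_kernel. Qed.

Lemma flat_j_mono A X : Mono (flat_j A X).
Proof. exact: kernel_mono (flat_j_kernel A X). Qed.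

Lemma flat_map_j A X A' X' (f : Hom A A') (g : Hom X X') :
  flat_map f g ;; flat_j A' X' = flat_j A X ;; cpmap f g.
Proof. exact: pair_pr1. Qed.

Lemma flat_unit_j A X : flat_unit A X ;; flat_j A X = inr A X.
Proof. exact: pair_pr1. Qed.

Lemma flat_mult_j A X :
  flat_mult A X ;; flat_j A X = flat_j A (Flat A X) ;; copair (inl A X) (flat_j A X).
Proof. exact: pair_pr1. Qed.

Lemma copair_post A B T S (u : Hom A T) (v : Hom B T) (f : Hom T S) :
  copair u v ;; f = copair (u ;; f) (v ;; f).
Proof. by apply: copair_uniq; catd. Qed.

Lemma cpmap_copair A B A' B' T (f : Hom A A') (g : Hom B B') (u : Hom A' T) (v : Hom B' T) :
  cpmap f g ;; copair u v = copair (f ;; u) (g ;; v).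
Proof. by rewrite /cpmap copair_post; catd. Qed.

Lemma flat_map_comp A A' A'' X (f : Hom A A') (g : Hom A' A'') :
  flat_map (f ;; g) (idm X) = flat_map f (idm X) ;; flat_map g (idm X).
Proof.
apply: flat_j_mono; rewrite comp_assoc !flat_map_j -comp_assoc flat_map_j comp_assoc.
by f_equal; rewrite /cpmap copair_post; catd.
Qed.

Lemma Compat_post A X T S (xi : Hom (Flat A X) X) (a : Hom A T) (b : Hom X T) (f : Hom T S) :
  Compat xi a b -> Compat xi (a ;; f) (b ;; f).
Proof. by rewrite /Compat -copair_post -!comp_assoc => ->. Qed.

Lemma Compat_pre A A' X T (xi : Hom (Flat A X) X) (t : Hom A' A) (a : Hom A T) (b : Hom X T) :
  Compat xi a b -> Compat (flat_map t (idm X) ;; xi) (t ;; a) b.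
Proof.
rewrite /Compat comp_assoc => <-.
by rewrite -comp_assoc flat_map_j comp_assoc cpmap_copair; catd.
Qed.

Lemma Compat_zero A X T (xi : Hom (Flat A X) X) (a : Hom A T) : Compat xi a (zero X T).
Proof.
rewrite /Compat zero_r.
have -> : copair a (zero X T) = copair (idm A) (zero X A) ;; a.
  by rewrite copair_post; catd.
by rewrite -comp_assoc flat_j_zero zero_l.
Qed.

Lemma flat_map_conj A X (f : Hom X A) :
  flat_map (idm A) f ;; conj_action A = flat_j A X ;; copair (idm A) f.
Proof. by rewrite /conj_action -comp_assoc flat_map_j comp_assoc cpmap_copair; catd. Qed.

Lemma Compat_conj A X (xi : Hom (Flat A X) X) (f : Hom X A) :
  Compat xi (idm A) f <-> flat_map (idm A) f ;; conj_action A = xi ;; f.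
Proof. by rewrite flat_map_conj. Qed.

Lemma SplitExt_pullback B X A (xi : Hom (Flat B X) X) (p : Hom A B) (s : Hom B A) (k : Hom X A)
    B' (t : Hom B' B) (s' : Hom B' (Pb t p)) (k' : Hom X (Pb t p)) :
  SplitExt xi p s k ->
  s' ;; pr1 t p = idm B' -> s' ;; pr2 t p = t ;; s ->
  k' ;; pr1 t p = zero X B' -> k' ;; pr2 t p = k ->
  SplitExt (flat_map t (idm X) ;; xi) (pr1 t p) s' k'.
Proof.
move=> [sp kp c] s1 s2 k1 k2; split=> //.
- apply: kernel_intro => //.
    move=> T u v e; apply: (kernel_mono kp).
    by rewrite -k2 -!comp_assoc e.
  move=> T u u0.
  have [|x ex] := kernel_fac (u := u ;; pr2 t p) kp.
    by rewrite comp_assoc -pr_square -comp_assoc u0; catd.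
  by exists x; apply: pb_ext; cat; rewrite ?k1 ?k2 ?u0; catd.
- apply: pb_ext; rewrite !comp_assoc !copair_post ?s1 ?s2 ?k1 ?k2.
    by rewrite zero_r zero_r; apply: flat_j_zero.
  by rewrite -comp_assoc; apply: Compat_pre.
Qed.

End Actions.

Section SemiAbelianActions.
Context (C : PointedCategory) (sa : SemiAbelian C).
Implicit Types A B D E K T X Y : C.

Let proto : BournProtomodular C := proj1 sa.

(** The sum [B + X] covers [A], and the elements that it sends to zero lie in
    [B]-flat-[X] and are killed by [xi]; so a morphism that coequalizes factors
    through the cokernel [copair s k] of these elements. *)
Lemma SplitExt_coequalizer B X A (xi : Hom (Flat B X) X) (p : Hom A B) (s : Hom B A)
    (k : Hom X A) :
  SplitExt xi p s k -> IsCoequalizer (flat_j B X) (xi ;; inr B X) (copair s k).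
Proof.
move=> [sp kp c].
have rq : RegularEpi (copair s k).
  apply: (extremal_regepi sa) => M m mm F.
  apply: (kernel_ind proto sp kp) => //; rewrite comp_id_r.
    by rewrite -(copair_inl s k); apply: Fac_pre.
  by rewrite -(copair_inr s k); apply: Fac_pre.
split; first by rewrite comp_assoc copair_inr; exact: c.
move=> T h eh.
have [|w ew] := regepi_kernel_factor sa (f := h) rq.
  move=> S u u0.
  have [|x ex] := kernel_fac (u := u) (flat_j_kernel B X).
    have -> : copair (idm B) (zero X B) = copair s k ;; p.
      by rewrite copair_post sp (proj1 kp).
    by rewrite -comp_assoc u0; catd.
  have x0 : x ;; xi = zero S X.
    by apply: (kernel_mono kp); rewrite comp_assoc -c -comp_assoc ex u0; catd.
  by rewrite -ex comp_assoc eh -!comp_assoc x0; catd.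
by exists w; split=> // w' ew'; apply: (regepi_epi rq); rewrite ew.
Qed.

(** Compatible pairs are the morphisms out of the semidirect product; the converse is
    [Compat_post] applied to [se_compat]. *)
Lemma SplitExt_lift B X A (xi : Hom (Flat B X) X) (p : Hom A B) (s : Hom B A) (k : Hom X A)
    T (a : Hom B T) (b : Hom X T) :
  SplitExt xi p s k -> Compat xi a b -> exists f, s ;; f = a /\ k ;; f = b.
Proof.
move=> /SplitExt_coequalizer [_ U] c.
have [|f [ef _]] := U _ (copair a b); first by rewrite comp_assoc copair_inr.
exists f; rewrite -(copair_inl s k) -{2}(copair_inr s k) !comp_assoc ef.
by rewrite copair_inl copair_inr.
Qed.

(** The semidirect product is the quotient of [B + X] by the reflexive pair that
    identifies [flat_j] with [xi].  Its kernel is [X] because, restricted to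
    kernels, the pair becomes the canonical presentation of the algebra [xi] by
    [flat_mult] and [flat_map (idm B) xi], which is a split coequalizer. *)
Lemma semidirect B X (xi : Hom (Flat B X) X) :
  IsAction xi ->
  exists (A : C) (p : Hom A B) (s : Hom B A) (k : Hom X A), SplitExt xi p s k.
Proof.
move=> [ax_unit ax_mult].
pose a := copair (inl B X) (flat_j B X).
pose b := copair (inl B X) (xi ;; inr B X).
pose r := copair (inl B (Flat B X)) (flat_unit B X ;; inr B (Flat B X)).
pose pi := copair (idm B) (zero X B).
have ra : r ;; a = idm (Cp B X).
  by rewrite /r copair_post /a; cat; rewrite flat_unit_j; apply: copair_uniq; catd.
have rb : r ;; b = idm (Cp B X).
  rewrite /r copair_post /b; cat; rewrite (comp_congr_r ax_unit).
  by apply: copair_uniq; catd.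
have pa : a ;; pi = copair (idm B) (zero (Flat B X) B).
  by rewrite /a copair_post /pi copair_inl flat_j_zero.
have pb : b ;; pi = copair (idm B) (zero (Flat B X) B).
  by rewrite /b copair_post /pi; catd.
have [A [q [rq H]]] := reflexive_quotient sa ra rb.
have [p qp] : exists p, q ;; p = pi.
  apply: (regepi_factor (f := pi) rq) => T u v /H [S [c [w [rc [e1 e2]]]]].
  by apply: (regepi_epi rc); rewrite -!comp_assoc e1 e2 !comp_assoc pa pb.
have ab : a ;; q = b ;; q.
  apply/H; exists (Cp B (Flat B X)), (idm _), (idm _); split; last by catd.
  by apply: (split_regepi sa (s := idm _)); catd.
have jq : flat_j B X ;; q = xi ;; (inr B X ;; q).
  transitivity (inr B (Flat B X) ;; a ;; q); first by rewrite /a copair_inr.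
  by rewrite comp_assoc ab /b; catd.
have mk : Mono (inr B X ;; q).
  move=> T u v; rewrite -!comp_assoc => /H [S [c [w [rc [e1 e2]]]]].
  have w0 : w ;; copair (idm B) (zero (Flat B X) B) = zero S B.
    by rewrite -pa -comp_assoc -e1 /pi; catd.
  have [x ex] := kernel_fac (flat_j_kernel _ _) w0.
  have x1 : x ;; flat_mult B X = c ;; u ;; flat_unit B X.
    apply: flat_j_mono; rewrite !comp_assoc flat_mult_j flat_unit_j.
    move: e1; rewrite -ex /a !comp_assoc => ->; catd.
  have x2 : x ;; flat_map (idm B) xi = c ;; v ;; flat_unit B X.
    apply: flat_j_mono; rewrite !comp_assoc flat_map_j flat_unit_j.
    move: e2; rewrite -ex /b /cpmap !comp_assoc => ->; catd.
  apply: (regepi_epi rc).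
  rewrite -(comp_id_r u) -(comp_id_r v) -ax_unit.
  by rewrite -!(comp_assoc c) -!(comp_assoc (c ;; _)) -x1 -x2 !comp_assoc ax_mult.
have kk : IsKernel (inr B X ;; q) p.
  apply: kernel_intro => //; first by rewrite comp_assoc qp; exact: copair_inr.
  move=> T t t0.
  have [S [c [y [rc ey]]]] := cover_lift sa t rq.
  have [|z ez] := kernel_fac (u := y) (flat_j_kernel B X).
    by rewrite -/pi -qp -comp_assoc -ey comp_assoc t0; catd.
  apply: (cover_fac rc mk).
  by exists (z ;; xi); rewrite ey -ez !comp_assoc jq; catd.
exists A, p, (inl B X ;; q), (inr B X ;; q); split=> //.
  by rewrite comp_assoc qp; exact: copair_inl.
rewrite /Compat -copair_post.
have -> : copair (inl B X) (inr B X) = idm (Cp B X) by apply: copair_uniq; catd.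
by rewrite comp_id_l.
Qed.

(** Two elements [x] and [y] are to be identified when they are the images of one
    element of [A + K] under [(1, 0)] and [(1, m)].  The class of zero is then the
    image of [A]-flat-[K] under [flat_j] and [(1, m)], the normal closure of [m];
    it is [m] by the hypothesis of stability. *)
Lemma conj_stable_normal K A (m : Hom K A) :
  Mono m -> Fac (flat_j A K ;; copair (idm A) m) m ->
  exists Q (q : Hom A Q), IsKernel m q /\ IsCokernel m q.
Proof.
move=> mm [xi exi].
pose a := copair (idm A) (zero K A); pose b := copair (idm A) m.
have [Q [q [rq H]]] := reflexive_quotient sa (copair_inl (idm A) (zero K A) : inl A K ;; a = _)
                         (copair_inl (idm A) m : inl A K ;; b = _).
have km : IsKernel m q; last by exists Q, q; split=> //; apply: (regepi_cokernel sa).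
apply: kernel_intro => //.
  have -> : zero K Q = zero K A ;; q by cat.
  symmetry; apply/H; exists K, (idm K), (inr A K); split.
    by apply: (split_regepi sa (s := idm K)); catd.
  by rewrite /a /b !copair_inr; catd.
move=> T t t0.
have /H [S [c [w [rc [e1 e2]]]]] : zero T A ;; q = t ;; q by rewrite t0; cat.
have [|x ex] := kernel_fac (u := w) (flat_j_kernel A K); first by rewrite -e1; cat.
apply: (cover_fac rc mm); exists (x ;; xi).
by rewrite e2 -ex !comp_assoc exi.
Qed.

(** The equation lives over [Flat Q X] and not over [Q], so [q] does not simply cancel.
    But the semidirect products over [P] and [Q] are both pulled back from the one
    over [B]; hence the former covers the latter, with the kernel of [q] as kernel,
    and the morphism that extends [(q ;; a, b)] factors. *)
Lemma Compat_descend P Q B X T (q : Hom P Q) (sg : Hom Q B) (xi : Hom (Flat B X) X)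
    (a : Hom Q T) (b : Hom X T) :
  IsAction xi -> RegularEpi q ->
  Compat (flat_map (q ;; sg) (idm X) ;; xi) (q ;; a) b ->
  Compat (flat_map sg (idm X) ;; xi) a b.
Proof.
move=> act rq c.
have [A [p [s [k se]]]] := semidirect act.
have sp := se_section se; have kp := proj1 (se_kernel se).
have sP : idm P ;; (q ;; sg) = q ;; sg ;; s ;; p by rewrite !comp_assoc sp; catd.
have kP : zero X P ;; (q ;; sg) = k ;; p by rewrite kp; catd.
have sQ : idm Q ;; sg = sg ;; s ;; p by rewrite !comp_assoc sp; catd.
have kQ : zero X Q ;; sg = k ;; p by rewrite kp; catd.
have seP : SplitExt (flat_map (q ;; sg) (idm X) ;; xi) (pr1 (q ;; sg) p) (pair sP) (pair kP).
  by apply: (SplitExt_pullback se); rewrite ?pair_pr1 ?pair_pr2.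
have seQ : SplitExt (flat_map sg (idm X) ;; xi) (pr1 sg p) (pair sQ) (pair kQ).
  by apply: (SplitExt_pullback se); rewrite ?pair_pr1 ?pair_pr2.
have [f [sf kf]] := SplitExt_lift seP c.
have gP : pr1 (q ;; sg) p ;; q ;; sg = pr2 (q ;; sg) p ;; p by rewrite comp_assoc pr_square.
pose g := pair gP.
have rg : RegularEpi g.
  apply: (proj2 (proj1 (proj2 sa)) _ _ _ _ g (pr1 (q ;; sg) p) (pr1 sg p) q) => //.
  split; first exact: pair_pr1.
  move=> S u v e.
  have w0 : v ;; (q ;; sg) = u ;; pr2 sg p ;; p.
    by rewrite comp_assoc -pr_square -!comp_assoc e.
  exists (pair w0); split.
    by split; [apply: pb_ext; rewrite /g|]; catd.
  move=> w [e1 e2]; apply: pb_ext; first by rewrite pair_pr1.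
  by rewrite pair_pr2 -e1 /g; catd.
have [|f' ef'] := regepi_kernel_factor sa (f := f) rg.
  move=> S u u0.
  have u1 : u ;; pr1 (q ;; sg) p ;; q = zero S Q.
    by move: (f_equal (fun z => z ;; pr1 sg p) u0); rewrite /g; cat.
  have u2 : u ;; pr2 (q ;; sg) p = zero S A.
    by move: (f_equal (fun z => z ;; pr2 sg p) u0); rewrite /g; cat.
  have -> : u = u ;; pr1 (q ;; sg) p ;; pair sP.
    apply: pb_ext; catd; rewrite u2 -!comp_assoc u1; catd.
  by rewrite comp_assoc sf -comp_assoc u1; catd.
have -> : a = pair sQ ;; f'.
  apply: (regepi_epi rq); rewrite -sf -ef' -!comp_assoc; f_equal.
  by apply: pb_ext; rewrite /g; catd.
have -> : b = pair kQ ;; f'.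
  rewrite -kf -ef' -comp_assoc; f_equal.
  by apply: pb_ext; rewrite /g; catd.
by apply: Compat_post; apply: (se_compat seQ).
Qed.

End SemiAbelianActions.

(** * Composition of butterflies *)

Section Composition.
Context (C : PointedCategory) (sa : SemiAbelian C).
Implicit Types A B D E K T X Y : C.

Let proto : BournProtomodular C := proj1 sa.

Lemma Compat_pb A X (xi : Hom (Flat A X) X) B B' D (f : Hom B D) (g : Hom B' D)
    (a : Hom A (Pb f g)) (b : Hom X (Pb f g)) :
  Compat xi (a ;; pr1 f g) (b ;; pr1 f g) -> Compat xi (a ;; pr2 f g) (b ;; pr2 f g) ->
  Compat xi a b.
Proof. by move=> c1 c2; apply: pb_ext; rewrite !comp_assoc copair_post. Qed.

Lemma kappa_compat (H G : CrossedModule C) (E : Butterfly H G) T (t : Hom T (bf_ob E)) :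
  Compat (flat_map (t ;; sigma E) (idm _) ;; act H) t (kappa E).
Proof.
rewrite flat_map_comp comp_assoc -{2}(comp_id_r t); apply: Compat_pre.
by apply/Compat_conj; exact: kappa_equivariant.
Qed.

Lemma iota_compat (H G : CrossedModule C) (E : Butterfly H G) T (t : Hom T (bf_ob E)) :
  Compat (flat_map (t ;; rho E) (idm _) ;; act G) t (iota E).
Proof.
rewrite flat_map_comp comp_assoc -{2}(comp_id_r t); apply: Compat_pre.
by apply/Compat_conj; exact: iota_equivariant.
Qed.

Lemma sigma_regepi (H G : CrossedModule C) (E : Butterfly H G) : RegularEpi (sigma E).
Proof. exact: cokernel_regepi (sigma_cokernel E). Qed.

Lemma iota_mono (H G : CrossedModule C) (E : Butterfly H G) : Mono (iota E).
Proof. exact: kernel_mono (iota_kernel E). Qed.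

(** The pullback acts on the top object of [G] through the base of [G]; both
    [iota E] and [kappa E'] are equivariant, so [(iota, kappa')] is stable under
    conjugation. *)
Lemma middle_normal (H G K : CrossedModule C) (E : Butterfly H G) (E' : Butterfly G K) :
  exists Q (q : Hom (BfPb E E') Q),
    IsKernel (pair (comp_middle_proof E E')) q /\ IsCokernel (pair (comp_middle_proof E E')) q.
Proof.
have rs : bf_r E E' ;; rho E = bf_s E E' ;; sigma E' by exact: pr_square.
apply: (conj_stable_normal sa).
  move=> T u v /(f_equal (fun z => z ;; bf_r E E')); rewrite !comp_assoc /bf_r pair_pr1.
  exact: iota_mono.
exists (flat_map (bf_r E E' ;; rho E) (idm _) ;; act G).
symmetry; apply: Compat_pb; rewrite comp_id_l.
  by rewrite pair_pr1; apply: iota_compat.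
by rewrite pair_pr2 rs; apply: kappa_compat.
Qed.

(** That [iota] of the composite is the kernel of [sigma] is checked in the pullback.
    The pairs sent to zero in the base of [H] form a point over the top object of
    [G], with section [(iota, kappa')] and kernel the top object of [K]; modulo
    [(iota, kappa')] only the latter survives. *)
Lemma composite_exists (H G K : CrossedModule C) (E : Butterfly H G) (E' : Butterfly G K) :
  inhabited {F : Butterfly H K & CompositeOf E E' F}.
Proof.
pose r := bf_r E E'; pose s := bf_s E E'.
have rs : r ;; rho E = s ;; sigma E' by exact: pr_square.
pose m : Hom _ (BfPb E E') := pair (comp_middle_proof E E').
have mr : m ;; r = iota E by exact: pair_pr1.
have ms : m ;; s = kappa E' by exact: pair_pr2.
have [Q [q [kq cq]]] : exists Q (q : Hom (BfPb E E') Q), IsKernel m q /\ IsCokernel m q.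
  exact: middle_normal.
have rq := cokernel_regepi cq.
pose k0 : Hom _ (BfPb E E') := pair (comp_kappa_proof E E').
pose i0 : Hom _ (BfPb E E') := pair (comp_iota_proof E E').
have k0r : k0 ;; r = kappa E by exact: pair_pr1.
have k0s : k0 ;; s = zero _ _ by exact: pair_pr2.
have i0r : i0 ;; r = zero _ _ by exact: pair_pr1.
have i0s : i0 ;; s = iota E' by exact: pair_pr2.
have [sg qsg] : exists sg, q ;; sg = r ;; sigma E.
  by apply: (coker_lift cq); rewrite -comp_assoc mr (proj1 (iota_kernel E)).
have [rh qrh] : exists rh, q ;; rh = s ;; rho E'.
  by apply: (coker_lift cq); rewrite -comp_assoc ms kappa_rho.
have rsg : RegularEpi sg.
  apply: (regepi_cancel sa (f := q)); rewrite qsg; apply: (regepi_comp sa).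
    exact: (regepi_pr1 sa _ (sigma_regepi E')).
  exact: sigma_regepi.
have mi : Mono (i0 ;; q).
  apply: (mono_of_trivial_kernel proto) => T u; rewrite -comp_assoc => u0.
  have [x ex] := kernel_fac kq u0.
  have x0 : x = zero _ _.
    apply: (@iota_mono _ _ E); move: (f_equal (fun z => z ;; r) ex).
    by cat; rewrite mr i0r; cat.
  apply: (@iota_mono _ _ E'); move: (f_equal (fun z => z ;; s) ex).
  by rewrite x0; cat; rewrite i0s => <-.
have ki : IsKernel (i0 ;; q) sg.
  apply: kernel_intro => //; first by rewrite comp_assoc qsg -comp_assoc i0r; catd.
  move=> T t t0.
  have [S [c [y [rc ey]]]] := cover_lift sa t rq.
  pose n := ker (r ;; sigma E).
  have kn : n ;; r ;; sigma E = zero _ _ by rewrite comp_assoc; exact: ker_zero.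
  have [h eh] := kernel_fac (iota_kernel E) kn.
  have m0 : m ;; (r ;; sigma E) = zero _ _ by rewrite -comp_assoc mr (proj1 (iota_kernel E)).
  have mn : ker_lift m0 ;; n = m by exact: pair_pr1.
  have F : Fac (n ;; q) (i0 ;; q).
  { apply: (point_ind proto (p := h) (s := ker_lift m0) (v := fromZ _)) => //.
    - by apply: (@iota_mono _ _ E); rewrite comp_assoc eh -comp_assoc mn mr; catd.
    - exists (zero _ _); rewrite -(comp_assoc (ker_lift m0)) mn (proj1 kq); catd.
    - move=> V u w ew.
      have u0 : u ;; h = zero _ _ by rewrite -ew comp_fromZ.
      have ur : u ;; n ;; r = zero _ _ by rewrite comp_assoc -eh -comp_assoc u0; catd.
      have [|x ex] := kernel_fac (u := u ;; n ;; s) (iota_kernel E').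
        by rewrite comp_assoc -rs -comp_assoc ur; catd.
      exists x; rewrite -!comp_assoc; f_equal.
      apply: pb_ext; rewrite -/(bf_r E E') -/(bf_s E E') -/r -/s comp_assoc.
        by rewrite i0r ur; catd.
      by rewrite i0s ex. }
  have [|y' ey'] := kernel_fac (u := y) (ker_kernel (r ;; sigma E)).
    by rewrite -qsg -comp_assoc -ey comp_assoc t0; catd.
  by apply: (cover_fac rc mi); rewrite ey -ey' comp_assoc; apply: Fac_pre.
have eqk : flat_map (idm Q) (k0 ;; q) ;; conj_action Q
           = flat_map sg (idm _) ;; act H ;; (k0 ;; q).
  apply/Compat_conj; apply: (Compat_descend sa (act_action H) rq).
  have c : Compat (flat_map (r ;; sigma E) (idm _) ;; act H) (idm (BfPb E E')) k0.
    apply: Compat_pb; first by rewrite comp_id_l pair_pr1; apply: kappa_compat.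
    by rewrite pair_pr2; apply: Compat_zero.
  by move: (Compat_post q c); rewrite comp_id_l comp_id_r qsg.
have eqi : flat_map (idm Q) (i0 ;; q) ;; conj_action Q
           = flat_map rh (idm _) ;; act K ;; (i0 ;; q).
  apply/Compat_conj; apply: (Compat_descend sa (act_action K) rq).
  have c : Compat (flat_map (s ;; rho E') (idm _) ;; act K) (idm (BfPb E E')) i0.
    apply: Compat_pb; first by rewrite pair_pr1; apply: Compat_zero.
    by rewrite comp_id_l pair_pr2; apply: iota_compat.
  by move: (Compat_post q c); rewrite comp_id_l comp_id_r qrh.
have ks : k0 ;; q ;; sg = bd H by rewrite comp_assoc qsg -comp_assoc k0r kappa_sigma.
have ir : i0 ;; q ;; rh = bd K by rewrite comp_assoc qrh -comp_assoc i0s iota_rho.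
have kr : k0 ;; q ;; rh = zero _ _ by rewrite comp_assoc qrh -comp_assoc k0s; catd.
have ci := regepi_cokernel sa rsg ki.
constructor; exists (Build_Butterfly ks ir kr ki ci eqk eqi).
exact: (Build_CompositeOf (F := Build_Butterfly ks ir kr ki ci eqk eqi) cq).
Qed.

End Composition.

(** * Internal groupoids *)

Section Groupoids.
Context (C : PointedCategory) (sa : SemiAbelian C).
Implicit Types A B D E K T X Y : C.

Let proto : BournProtomodular C := proj1 sa.

Section Unital.
Context (G0 G1 : C) (d c : Hom G1 G0) (e : Hom G0 G1) (m : Hom (Pb c d) G1).

(** [x] followed by [y] is [z].  A relation avoids carrying proofs of
    composability inside terms. *)
Definition Mul T (x y z : Hom T G1) : Prop :=
  exists w, w ;; pr1 c d = x /\ w ;; pr2 c d = y /\ w ;; m = z.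

Lemma Mul_fun T (x y z z' : Hom T G1) : Mul x y z -> Mul x y z' -> z = z'.
Proof.
move=> [w [w1 [w2 <-]]] [w' [w1' [w2' <-]]]; f_equal.
by apply: pb_ext; rewrite ?w1 ?w2 ?w1' ?w2'.
Qed.

Lemma Mul_pre S T (t : Hom S T) (x y z : Hom T G1) :
  Mul x y z -> Mul (t ;; x) (t ;; y) (t ;; z).
Proof. by move=> [w [<- [<- <-]]]; exists (t ;; w); catd. Qed.

Lemma Mul_total T (x y : Hom T G1) : x ;; c = y ;; d -> exists z, Mul x y z.
Proof. by move=> h; exists (pair h ;; m), (pair h); catd. Qed.

Lemma Mul_pair T (x y : Hom T G1) (h : x ;; c = y ;; d) : Mul x y (pair h ;; m).
Proof. by exists (pair h); catd. Qed.

Lemma Mul_match T (x y z : Hom T G1) : Mul x y z -> x ;; c = y ;; d.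
Proof. by move=> [w [<- [<- _]]]; rewrite !comp_assoc pr_square. Qed.

Hypothesis (ed : e ;; d = idm G0) (ec : e ;; c = idm G0).
Hypothesis unit_l : Mul (d ;; e) (idm G1) (idm G1).
Hypothesis unit_r : Mul (idm G1) (c ;; e) (idm G1).

Lemma Mul_1l T (x y : Hom T G1) : x = y ;; d ;; e -> Mul x y y.
Proof. by move: (Mul_pre y unit_l); rewrite comp_id_r comp_assoc => H ->. Qed.

Lemma Mul_1r T (x y : Hom T G1) : y = x ;; c ;; e -> Mul x y x.
Proof. by move: (Mul_pre x unit_r); rewrite comp_id_r comp_assoc => H ->. Qed.

Let E1 : idm G1 ;; c = c ;; e ;; d. Proof. by rewrite comp_assoc ed; catd. Qed.
Let E2 : d ;; e ;; c = idm G1 ;; d. Proof. by rewrite comp_assoc ec; catd. Qed.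

Lemma unital_epic T (f f' : Hom (Pb c d) T) :
  pair E1 ;; f = pair E1 ;; f' -> pair E2 ;; f = pair E2 ;; f' -> f = f'.
Proof. by apply: (points_epic proto ec ed); catd. Qed.

Lemma unital_dom : m ;; d = pr1 c d ;; d.
Proof.
apply: unital_epic; rewrite -!comp_assoc.
  by rewrite (Mul_fun (Mul_pair E1) unit_r); catd.
by rewrite (Mul_fun (Mul_pair E2) unit_l); cat; rewrite ?ed; catd.
Qed.

Lemma unital_cod : m ;; c = pr2 c d ;; c.
Proof.
apply: unital_epic; rewrite -!comp_assoc.
  by rewrite (Mul_fun (Mul_pair E1) unit_r); cat; rewrite ?ec; catd.
by rewrite (Mul_fun (Mul_pair E2) unit_l); catd.
Qed.

Lemma Mul_dom T (x y z : Hom T G1) : Mul x y z -> z ;; d = x ;; d.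
Proof. by move=> [w [<- [_ <-]]]; rewrite !comp_assoc unital_dom. Qed.

Lemma Mul_cod T (x y z : Hom T G1) : Mul x y z -> z ;; c = y ;; c.
Proof. by move=> [w [_ [<- <-]]]; rewrite !comp_assoc unital_cod. Qed.

(** Associativity need only be tested on triples in which the last arrow, or
    the first two arrows, are identities. *)
Lemma Mul_assoc T (x y z xy yz l r : Hom T G1) :
  Mul x y xy -> Mul xy z l -> Mul y z yz -> Mul x yz r -> l = r.
Proof.
pose p := pr2 c d ;; c.
have ee : e ;; c = e ;; d by rewrite ec ed.
have sp : pair ee ;; p = idm G0 by rewrite /p; cat.
pose X := pr1 p d ;; pr1 c d; pose Y := pr1 p d ;; pr2 c d; pose Z := pr2 p d.
have XYd : X ;; c = Y ;; d by rewrite /X /Y !comp_assoc pr_square.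
have YZd : Y ;; c = Z ;; d by rewrite /Y /Z comp_assoc -/p pr_square.
have [XY HXY] := Mul_total XYd.
have [YZ HYZ] := Mul_total YZd.
have [L HL] : exists L, Mul XY Z L by apply: Mul_total; rewrite (Mul_cod HXY).
have [R HR] : exists R, Mul X YZ R by apply: Mul_total; rewrite (Mul_dom HYZ).
have U : L = R.
{ have q1 : idm _ ;; p = p ;; e ;; d by rewrite comp_assoc ed; catd.
  have q2 : d ;; pair ee ;; p = idm _ ;; d by rewrite comp_assoc sp; catd.
  have x1 : pair q1 ;; X = pr1 c d by rewrite /X; cat.
  have y1 : pair q1 ;; Y = pr2 c d by rewrite /Y; cat.
  have z1 : pair q1 ;; Z = pr2 c d ;; c ;; e by rewrite /Z pair_pr2.
  have x2 : pair q2 ;; X = d ;; e by rewrite /X; cat.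
  have y2 : pair q2 ;; Y = d ;; e by rewrite /Y; cat.
  have z2 : pair q2 ;; Z = idm G1 by rewrite /Z pair_pr2.
  clearbody X Y Z.
  apply: (points_epic proto sp ed (e1 := pair q1) (e2 := pair q2)); catd.
  - have := Mul_pre (pair q1) HXY; have := Mul_pre (pair q1) HYZ.
    have := Mul_pre (pair q1) HL; have := Mul_pre (pair q1) HR.
    rewrite x1 y1 z1 => r1 l1 yz1 xy1.
    have e_yz := Mul_fun yz1 (Mul_1r (eq_refl _)).
    rewrite e_yz in r1.
    rewrite (Mul_fun r1 xy1).
    by apply: Mul_fun l1 (Mul_1r _); rewrite (Mul_cod xy1).
  - have := Mul_pre (pair q2) HXY; have := Mul_pre (pair q2) HYZ.
    have := Mul_pre (pair q2) HL; have := Mul_pre (pair q2) HR.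
    rewrite x2 y2 z2 => r2 l2 yz2 xy2.
    have dd : d ;; e = d ;; e ;; d ;; e by rewrite !comp_assoc -(comp_assoc e) ed; catd.
    rewrite (Mul_fun xy2 (Mul_1l dd)) in l2.
    have e_yz : pair q2 ;; YZ = idm _ by apply: Mul_fun yz2 (Mul_1l _); catd.
    rewrite e_yz in r2.
    by rewrite (Mul_fun l2 r2). }
move=> [w [w1 [w2 w3]]] [v [v1 [v2 v3]]] hyz hr.
have vt : w ;; p = z ;; d.
  rewrite /p -v2 -comp_assoc w2 comp_assoc -pr_square -comp_assoc v1 -w3 comp_assoc unital_cod.
  by rewrite -comp_assoc w2.
have ex : pair vt ;; X = x by rewrite /X; cat.
have ey : pair vt ;; Y = y by rewrite /Y; cat.
have ez : pair vt ;; Z = z by rewrite /Z pair_pr2.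
have hxy : Mul x y xy by exists w.
have hl : Mul xy z l by exists v.
have := Mul_pre (pair vt) HXY; rewrite ex ey => /(Mul_fun hxy) e1.
have := Mul_pre (pair vt) HYZ; rewrite ey ez => /(Mul_fun hyz) e2.
have := Mul_pre (pair vt) HL; rewrite -e1 ez => /(Mul_fun hl) ->.
by have := Mul_pre (pair vt) HR; rewrite -e2 ex => /(Mul_fun hr) ->; rewrite U.
Qed.

(** Left division by an arrow is possible because [(x, y) |-> (x, x y)] is a
    morphism of points over [G1] which, by the left unit law, is bijective on
    kernels. *)
Lemma unital_inverse : exists i : Hom G1 G1, Mul (idm G1) i (d ;; e) /\ i ;; c = d.
Proof.
have sm : pr1 c d ;; d = m ;; d by rewrite unital_dom.
have dg : idm G1 ;; d = idm G1 ;; d by [].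
have [k [_ k1]] : IsIso (pair sm).
{ apply: (split_five proto (p := pr1 c d) (s := pair E1) (p' := pr1 d d) (s' := pair dg)); catd.
  - apply: pb_ext; catd.
    by rewrite (Mul_fun (Mul_pair E1) unit_r).
  - move=> T u u0.
    have h : zero T G1 ;; c = u ;; pr2 d d ;; d.
      by rewrite comp_assoc -pr_square -comp_assoc u0; catd.
    exists (pair h); split; first by catd.
    apply: pb_ext; first by rewrite u0; catd.
    cat; apply: Mul_fun (Mul_pair h) (Mul_1l _).
    by rewrite -h; catd.
  - move=> T u v u0 v0 euv; apply: pb_ext; first by rewrite u0 v0.
    have key w : w ;; pr1 c d = zero T G1 -> w ;; pr2 c d = w ;; m.
      move=> w0; apply: (Mul_fun (x := zero T G1) (y := w ;; pr2 c d) (Mul_1l _)); last by exists w.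
      by rewrite !comp_assoc -(comp_assoc (pr2 c d)) -pr_square -!comp_assoc w0; catd.
    rewrite !key //.
    by move: (f_equal (fun z => z ;; pr2 d d) euv); cat. }
have h : idm G1 ;; d = d ;; e ;; d by rewrite comp_assoc ed; catd.
have kp1 : k ;; pr1 c d = pr1 d d by rewrite -[RHS]comp_id_l -k1; catd.
have km : k ;; m = pr2 d d by rewrite -[RHS]comp_id_l -k1; catd.
have M : Mul (idm G1) (pair h ;; k ;; pr2 c d) (d ;; e).
  by exists (pair h ;; k); rewrite !comp_assoc kp1 km; catd.
by exists (pair h ;; k ;; pr2 c d); split=> //; rewrite -(Mul_cod M) comp_assoc ec; catd.
Qed.

(** Right inverses are two-sided: if [x'] is the right inverse of [x], and [x''] that
    of [x'], then [x'' = x] by associativity. *)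
Lemma unital_groupoid : exists gp : Groupoid d c e, gpd_mult gp = m.
Proof.
have [i [Mi ic]] := unital_inverse.
have id_ : i ;; d = c by move: (Mul_match Mi); cat => ->.
have Mii : Mul i (i ;; i) (c ;; e).
  by move: (Mul_pre i Mi); rewrite comp_id_r -comp_assoc id_.
have ii : i ;; i = idm G1.
  apply: (Mul_assoc (x := idm G1) (y := i) (z := i ;; i) Mi _ Mii unit_r).
  by apply: Mul_1l; rewrite !comp_assoc (comp_congr_r id_) (comp_congr_r ic).
rewrite ii in Mii.
unshelve eexists; first apply: (@Build_Groupoid C G0 G1 d c e m i) => //.
- exact: unital_dom.
- exact: unital_cod.
- by move=> h; apply: Mul_fun (Mul_pair h) unit_l.
- by move=> h; apply: Mul_fun (Mul_pair h) unit_r.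
- move=> T x y z hxy hyz h h'.
  exact: Mul_assoc (Mul_pair hxy) (Mul_pair h) (Mul_pair hyz) (Mul_pair h').
- by move=> h; apply: Mul_fun (Mul_pair h) Mi.
- by move=> h; apply: Mul_fun (Mul_pair h) Mii.
- by [].
Qed.

End Unital.

Section Laws.
Context (G0 G1 : C) (d c : Hom G1 G0) (e : Hom G0 G1) (gp : Groupoid d c e).
Let m := gpd_mult gp.
Let i := gpd_inv gp.

Lemma gpd_unit_l_Mul : Mul m (d ;; e) (idm G1) (idm G1).
Proof.
have h : d ;; e ;; c = idm G1 ;; d by rewrite comp_assoc (gpd_e_cod gp); catd.
by rewrite -{2}(gpd_unit_l gp h); apply: Mul_pair.
Qed.

Lemma gpd_unit_r_Mul : Mul m (idm G1) (c ;; e) (idm G1).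
Proof.
have h : idm G1 ;; c = c ;; e ;; d by rewrite comp_assoc (gpd_e_dom gp); catd.
by rewrite -{2}(gpd_unit_r gp h); apply: Mul_pair.
Qed.

Lemma gpd_inv_r_Mul : Mul m (idm G1) i (d ;; e).
Proof.
have h : idm G1 ;; c = i ;; d by rewrite gpd_inv_dom; catd.
by rewrite -(gpd_inv_r (g := gp) h); apply: Mul_pair.
Qed.

Lemma gpd_inv_unit : e ;; i = e.
Proof.
have := Mul_pre e gpd_inv_r_Mul.
rewrite comp_id_r -comp_assoc (gpd_e_dom gp) comp_id_l => M.
apply: Mul_fun (Mul_1l gpd_unit_l_Mul _) M.
by rewrite (comp_assoc e) gpd_inv_dom (gpd_e_cod gp); catd.
Qed.

End Laws.
End Groupoids.

(** * Identity butterflies *)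

Section Identity.
Context (C : PointedCategory) (sa : SemiAbelian C).
Implicit Types A B D E K T X Y : C.

Let proto : BournProtomodular C := proj1 sa.

Lemma kernel_pair_sym A B (f : Hom A B) :
  exists s : Hom (Pb f f) (Pb f f), s ;; pr1 f f = pr2 f f /\ s ;; pr2 f f = pr1 f f.
Proof. by exists (pair (eq_sym (pr_square f f))); catd. Qed.

Lemma kernel_pair_trans A B (f : Hom A B) :
  exists t : Hom (Pb (pr2 f f) (pr1 f f)) (Pb f f),
    t ;; pr1 f f = pr1 (pr2 f f) (pr1 f f) ;; pr1 f f /\
    t ;; pr2 f f = pr2 (pr2 f f) (pr1 f f) ;; pr2 f f.
Proof.
have h : pr1 (pr2 f f) (pr1 f f) ;; pr1 f f ;; f = pr2 (pr2 f f) (pr1 f f) ;; pr2 f f ;; f.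
  by rewrite !comp_assoc pr_square -!comp_assoc pr_square !comp_assoc pr_square.
by exists (pair h); catd.
Qed.

Definition kernel_pair A B (f : Hom A B) : EquivRel A :=
  let refl := eq_refl (idm A ;; f) in
  Build_EquivRel (@pb_ext C _ _ _ f f) (pair_pr1 refl) (pair_pr2 refl)
    (kernel_pair_sym f) (kernel_pair_trans f).

Section Semidirect.
Context (G : CrossedModule C) (G1 : C) (d c : Hom G1 (xm_base G)) (e : Hom (xm_base G) G1)
  (g : Hom (xm_top G) G1).
Hypothesis (se : SplitExt (act G) c e g) (ed : e ;; d = idm (xm_base G)) (gd : g ;; d = bd G).

Let ec : e ;; c = idm (xm_base G) := se_section se.
Let gc : g ;; c = zero _ _ := proj1 (se_kernel se).

Section Star.
(** An arrow of [G1] with codomain zero is an element [h] of the top object of [G].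
    The star multiplication [f] sends [(h, y)] to the composite [y], then [h],
    which is again an arrow into zero. *)
Context (f : Hom (Pb (bd G) c) (xm_top G)).
Hypothesis f_unit : forall T (x : Hom T (Pb (bd G) c)),
  x ;; pr2 (bd G) c = x ;; pr1 (bd G) c ;; bd G ;; e -> x ;; f = x ;; pr1 (bd G) c.
Hypothesis f_kernel : forall T (x : Hom T (Pb (bd G) c)) (h : Hom T (xm_top G)),
  x ;; pr1 (bd G) c = zero _ _ -> x ;; pr2 (bd G) c = h ;; g -> x ;; f = h.

Let sX_eq : idm (xm_top G) ;; bd G = bd G ;; e ;; c.
Proof. by rewrite comp_assoc ec; catd. Qed.

Lemma star_kernel T (x : Hom T (Pb (bd G) c)) :
  x ;; pr1 (bd G) c = zero _ _ -> exists h, h ;; g = x ;; pr2 (bd G) c.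
Proof.
move=> x0; apply: (kernel_fac (se_kernel se)).
by rewrite comp_assoc -pr_square -comp_assoc x0; catd.
Qed.

Lemma star_dom : f ;; bd G = pr2 (bd G) c ;; d.
Proof.
apply: (kernel_epic_elt proto (p := pr1 (bd G) c) (s := pair sX_eq)); catd.
  rewrite -comp_assoc f_unit; catd.
  by rewrite ed; catd.
move=> T x x0; have [h eh] := star_kernel x0.
by rewrite -!comp_assoc (f_kernel x0 (eq_sym eh)) -eh comp_assoc gd.
Qed.

(** The second component of [phi] sends [(h', h)] to the arrow [y] such that [y]
    followed by [h'] is [h].  It exists because [(h', y) |-> (h', f (h', y))] is a
    morphism of points over [G] that is bijective on kernels. *)
Lemma star_division :
  exists phi : Hom (Prod (xm_top G) (xm_top G)) (Pb (bd G) c),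
    phi ;; pr1 (bd G) c = fstp _ _ /\ phi ;; f = sndp _ _ /\
    (forall T (x y : Hom T (Pb (bd G) c)),
       x ;; pr1 (bd G) c = y ;; pr1 (bd G) c -> x ;; f = y ;; f -> x = y).
Proof.
have [k [k1 k2]] : IsIso (prodpair (pr1 (bd G) c) f).
{ apply: (split_five proto (p := pr1 (bd G) c) (s := pair sX_eq)
            (p' := fstp _ _) (s' := prodpair (idm _) (idm _))); catd.
  - by apply: prod_ext; cat => //; rewrite f_unit; catd.
  - move=> T u u0.
    have h : zero T (xm_top G) ;; bd G = u ;; sndp _ _ ;; g ;; c.
      by cat; rewrite gc; catd.
    exists (pair h); split; first by catd.
    by apply: prod_ext; cat => //; rewrite (f_kernel (h := u ;; sndp _ _)); catd.
  - move=> T u v u0 v0 /(f_equal (fun z => z ;; sndp _ _)); cat => euv.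
    apply: pb_ext; first by rewrite u0 v0.
    have [h eh] := star_kernel u0; have [h' eh'] := star_kernel v0.
    rewrite -eh -eh'; move: euv.
    by rewrite (f_kernel u0 (eq_sym eh)) (f_kernel v0 (eq_sym eh')) => ->. }
exists k; split; last split.
- by rewrite -[RHS]comp_id_l -k2; catd.
- by rewrite -[RHS]comp_id_l -k2; catd.
- move=> T x y e1 e2; rewrite -(comp_id_r x) -(comp_id_r y) -k1 -!comp_assoc; f_equal.
  by apply: prod_ext; catd.
Qed.

(** On the kernel of the boundary, [f] is a unital operation, and the unit laws alone
    force commutativity, since the injections of a product are jointly epic. *)
Lemma star_comm T (z z' : Hom T (xm_top G)) (x x' : Hom T (Pb (bd G) c)) :
  z ;; bd G = zero _ _ -> z' ;; bd G = zero _ _ ->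
  x ;; pr1 (bd G) c = z -> x ;; pr2 (bd G) c = z' ;; g ->
  x' ;; pr1 (bd G) c = z' -> x' ;; pr2 (bd G) c = z ;; g -> x ;; f = x' ;; f.
Proof.
move=> z0 z0' x1 x2 x1' x2'.
pose k := ker (bd G); pose P := fstp (Ker (bd G)) (Ker (bd G)).
pose Q := sndp (Ker (bd G)) (Ker (bd G)).
have k0 : k ;; bd G = zero _ _ by exact: ker_zero.
have a : P ;; k ;; bd G = Q ;; k ;; g ;; c by cat; rewrite k0 gc; catd.
have b : Q ;; k ;; bd G = P ;; k ;; g ;; c by cat; rewrite k0 gc; catd.
have E : pair a ;; f = pair b ;; f.
{ have st T' (u : Hom T' (xm_top G)) (x0 : Hom T' (Pb (bd G) c)) :
    x0 ;; pr1 (bd G) c = u -> x0 ;; pr2 (bd G) c = zero _ _ -> u ;; bd G = zero _ _ ->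
    x0 ;; f = u.
    by move=> e1 e2 e0; rewrite f_unit ?e1 // e2 e0; catd.
  apply: (prod_epic proto); rewrite -!comp_assoc.
  - rewrite (st _ k) ?(f_kernel (h := k)) //; rewrite /P /Q; catd.
  - rewrite (f_kernel (h := k)) ?(st _ k) //; rewrite /P /Q; catd. }
have [y ey] := kernel_fac (u := z) (ker_kernel (bd G)) z0.
have [y' ey'] := kernel_fac (u := z') (ker_kernel (bd G)) z0'.
have -> : x = prodpair y y' ;; pair a.
  by apply: pb_ext; rewrite /P /Q /k; cat; rewrite ?(comp_congr_r ey') ?ey; catd.
have -> : x' = prodpair y y' ;; pair b.
  by apply: pb_ext; rewrite /P /Q /k; cat; rewrite ?(comp_congr_r ey) ?ey'; catd.
by rewrite !comp_assoc E -comp_assoc.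
Qed.

(** An arrow [l] out of zero is the inverse of some element of [G].  The relation of
    being joined by an arrow is symmetric, so some [h] runs, locally, from the
    codomain of [l] to zero.  By induction over such pairs [(h, l)] it remains to
    treat the loops [l] at zero, which are elements of the kernel of the boundary;
    by [star_comm], the inverse of the inverse of such a loop is the loop itself. *)
Lemma star_inverse_kernel (i0 : Hom (xm_top G) (Pb (bd G) c)) :
  (forall T (x y : Hom T (Pb (bd G) c)),
     x ;; pr1 (bd G) c = y ;; pr1 (bd G) c -> x ;; f = y ;; f -> x = y) ->
  i0 ;; pr1 (bd G) c = idm _ -> i0 ;; f = zero _ _ ->
  IsKernel (i0 ;; pr2 (bd G) c) d.
Proof.
move=> uniq i1 if0; set i := i0 ;; _.
have ic : i ;; c = bd G by rewrite comp_assoc -pr_square -comp_assoc i1; catd.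
have id0 : i ;; d = zero _ _ by rewrite comp_assoc -star_dom -comp_assoc if0; catd.
have mi : Mono i.
  apply: (mono_of_trivial_kernel proto) => T u u0.
  transitivity (u ;; i0 ;; f); last by rewrite comp_assoc if0; catd.
  have ub : u ;; bd G = zero _ _ by rewrite -ic -comp_assoc u0; catd.
  rewrite f_unit; last by rewrite comp_assoc i1; catd.
  by rewrite comp_assoc -/i u0 (comp_assoc u) i1 comp_id_r ub; catd.
apply: kernel_intro => // T l l0.
(* In the quotient of the base by the pair (d, c), two elements agree when, locally,
   an arrow runs from the first to the second; equality being symmetric, the arrow
   l from zero to [l ;; c] yields an arrow w in the opposite direction. *)
have [Q [q [rq H]]] := reflexive_quotient sa ed ec.
have dq : d ;; q = c ;; q.
  apply/H; exists G1, (idm _), (idm _); split; last by catd.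
  by apply: (split_regepi sa (s := idm _)); catd.
have /H [S [t [w [rt [ew0 ew1]]]]] : l ;; c ;; q = zero T (xm_base G) ;; q.
  by rewrite comp_assoc -dq -comp_assoc l0.
have [h eh] : exists h, h ;; g = w.
  by apply: (kernel_fac (se_kernel se)); rewrite -ew1; catd.
apply: (cover_fac rt mi).
have hl : h ;; bd G = t ;; l ;; c by rewrite comp_assoc ew0 -eh comp_assoc gd.
(* The pairs of h in G and l from zero to the domain of h form a point over G,
   split by the inverse of h; its kernel consists of loops at zero. *)
pose D := ker (pr2 (bd G) c ;; d).
have s0 : i0 ;; (pr2 (bd G) c ;; d) = zero _ _ by rewrite -comp_assoc.
have sD : ker_lift s0 ;; D = i0 by exact: pair_pr1.
have F : Fac (D ;; pr2 (bd G) c) i.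
{ apply: (point_ind proto (p := D ;; pr1 (bd G) c) (s := ker_lift s0) (v := fromZ _)) => //.
  - by rewrite -comp_assoc sD.
  - by exists (idm _); rewrite -comp_assoc sD comp_id_l.
  - move=> V u v ev.
    have u0 : u ;; D ;; pr1 (bd G) c = zero _ _ by rewrite comp_assoc -ev comp_fromZ.
    have [z ez] := star_kernel u0.
    have z0 : z ;; bd G = zero _ _.
      by rewrite -gd -comp_assoc ez !comp_assoc ker_zero; catd.
    have [z' ez'] : exists z', z' ;; g = z ;; i.
      by apply: (kernel_fac (se_kernel se)); rewrite comp_assoc ic.
    have z0' : z' ;; bd G = zero _ _.
      by rewrite -gd -comp_assoc ez' comp_assoc id0; catd.
    have hx : z' ;; bd G = z ;; g ;; c by rewrite z0' comp_assoc gc; catd.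
    exists z'; rewrite -comp_assoc -ez.
    have -> : z' ;; i = z' ;; i0 ;; pr2 (bd G) c by rewrite comp_assoc.
    have -> : z' ;; i0 = pair hx; last by exact: pair_pr2.
    apply: uniq; first by rewrite comp_assoc i1; catd.
    rewrite comp_assoc if0 zero_r.
    rewrite (star_comm (z := z') (z' := z) (x' := z ;; i0) z0' z0); catd.
    + by rewrite i1; catd.
    + by rewrite ez'.
    + by rewrite if0; catd. }
have [|y ey] := kernel_fac (u := pair hl) (ker_kernel (pr2 (bd G) c ;; d)).
  by rewrite -comp_assoc pair_pr2 comp_assoc l0; catd.
have <- : y ;; (D ;; pr2 (bd G) c) = t ;; l by rewrite -comp_assoc ey pair_pr2.
exact: Fac_pre.
Qed.

End Star.

(** The pullback of [c] along [bd] is the semidirect product for the action [act]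
    restricted along [bd].  By the Peiffer condition this action is conjugation,
    with which the pair of identities is compatible. *)
Lemma star_exists :
  exists f : Hom (Pb (bd G) c) (xm_top G),
    (forall T (x : Hom T (Pb (bd G) c)),
       x ;; pr2 (bd G) c = x ;; pr1 (bd G) c ;; bd G ;; e -> x ;; f = x ;; pr1 (bd G) c) /\
    (forall T (x : Hom T (Pb (bd G) c)) (h : Hom T (xm_top G)),
       x ;; pr1 (bd G) c = zero _ _ -> x ;; pr2 (bd G) c = h ;; g -> x ;; f = h).
Proof.
have hs : idm (xm_top G) ;; bd G = bd G ;; e ;; c by rewrite comp_assoc ec; catd.
have hk : zero (xm_top G) (xm_top G) ;; bd G = g ;; c by rewrite gc; catd.
have sx : SplitExt (flat_map (bd G) (idm _) ;; act G) (pr1 (bd G) c) (pair hs) (pair hk).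
  by apply: (SplitExt_pullback se); catd.
have [|f [sf kf]] := SplitExt_lift sa (a := idm _) (b := idm _) sx.
  by rewrite /Compat xm_peiffer comp_id_r.
exists f; split.
- move=> T x ex; have {1}-> : x = x ;; pr1 (bd G) c ;; pair hs.
    by apply: pb_ext; catd; rewrite ex; catd.
  by rewrite comp_assoc sf; catd.
- move=> T x h x1 x2; have -> : x = h ;; pair hk; last by rewrite comp_assoc kf; catd.
  by apply: pb_ext; catd.
Qed.

(** The required map [G * ker d -> G1] sends [(h, l)] to [h] followed by [l], which
    is the quotient of [h] by the inverse of [l]. *)
Lemma Huq_kernels :
  HuqCommute (normalization (kernel_pair c)) (normalization (kernel_pair d)).
Proof.
have [f [f1 f2]] := star_exists.
have [phi [p1 [p2 uniq]]] := star_division f1 f2.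
pose i0 := prodpair (idm (xm_top G)) (zero _ (xm_top G)) ;; phi.
have ki : IsKernel (i0 ;; pr2 (bd G) c) d.
  apply: (star_inverse_kernel f1 f2 uniq); rewrite /i0 comp_assoc.
    by rewrite p1; cat.
  by rewrite p2; cat.
have n0 (q : Hom G1 (xm_base G)) : normalization (kernel_pair q) ;; q = zero _ _.
  by rewrite /normalization comp_assoc pr_square -comp_assoc ker_zero; cat.
have [u eu] := kernel_fac (se_kernel se) (n0 c).
have [v ev] := kernel_fac ki (n0 d).
exists (prodpair (sndp _ _ ;; v) (fstp _ _ ;; u) ;; phi ;; pr2 (bd G) c); split.
- rewrite -eu; pose x := prodpair (zero (xm_top G) _) (idm (xm_top G)) ;; phi.
  have x1 : x ;; pr1 (bd G) c = zero _ _ by rewrite /x comp_assoc p1; cat.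
  have xf : x ;; f = idm _ by rewrite /x comp_assoc p2; cat.
  have [h eh] := star_kernel x1.
  have h1 : h = idm _ by rewrite -(f2 _ x h x1 (eq_sym eh)).
  have <- : x ;; pr2 (bd G) c = g by rewrite -eh h1; cat.
  rewrite -!comp_assoc; f_equal; f_equal.
  by apply: prod_ext; catd.
- rewrite -ev /i0 -!comp_assoc; f_equal; f_equal.
  by apply: prod_ext; catd.
Qed.

(** The composite of [x] and [y] is the value of the Smith operation at
    [(x, 1, y)], where [1] is the identity of the middle object. *)
Lemma unital_exists (hs : HuqEqSmith C) :
  exists m : Hom (Pb c d) G1, Mul m (d ;; e) (idm G1) (idm G1) /\ Mul m (idm G1) (c ;; e) (idm G1).
Proof.
have [Phi [P1 P2]] := hs _ _ _ Huq_kernels.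
have hR : pr1 c d ;; c = pr1 c d ;; c ;; e ;; c by rewrite !comp_assoc ec; catd.
have hS : pr2 c d ;; d ;; e ;; d = pr2 c d ;; d by rewrite !comp_assoc ed; catd.
have hm : pair hR ;; er2 (kernel_pair c) = pair hS ;; er1 (kernel_pair d).
  rewrite /= !pair_pr2 !pair_pr1.
  by rewrite pr_square.
exists (pair hm ;; Phi); split.
- have h : d ;; e ;; c = idm G1 ;; d by rewrite comp_assoc ec; catd.
  exists (pair h); split; first by catd.
  split; first by catd.
  have h' : d ;; e ;; d = idm G1 ;; d by rewrite comp_assoc ed; catd.
  have E : pair h ;; pair hm = pair h' ;; pair (smith_r (kernel_pair c) (kernel_pair d)).
    apply: pb_ext; rewrite !comp_assoc ?pair_pr1 ?pair_pr2; apply: pb_ext => /=; catd.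
    by rewrite (comp_congr_r ec); catd.
  by rewrite -comp_assoc E comp_assoc P2 /=; catd.
- have h : idm G1 ;; c = c ;; e ;; d by rewrite comp_assoc ed; catd.
  exists (pair h); split; first by catd.
  split; first by catd.
  have h' : idm G1 ;; c = c ;; e ;; c by rewrite comp_assoc ec; catd.
  have E : pair h ;; pair hm = pair h' ;; pair (smith_l (kernel_pair c) (kernel_pair d)).
    apply: pb_ext; rewrite !comp_assoc ?pair_pr1 ?pair_pr2; apply: pb_ext => /=; catd.
    by rewrite (comp_congr_r ed); catd.
  by rewrite -comp_assoc E comp_assoc P1 /=; catd.
Qed.

Section Inverse.
Context (gp : Groupoid d c e).
Let m := gpd_mult gp.
Let i := gpd_inv gp.

(** The morphism that sends a composable pair to its composite extends the pair
    [(1, g)] to the semidirect product for [act] restricted along [d]. *)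
Lemma iota_compat_dom : Compat (flat_map d (idm _) ;; act G) (idm G1) g.
Proof.
have hs : idm G1 ;; d = d ;; e ;; c by rewrite comp_assoc ec; catd.
have hk : zero (xm_top G) G1 ;; d = g ;; c by rewrite gc; catd.
have sx : SplitExt (flat_map d (idm _) ;; act G) (pr1 d c) (pair hs) (pair hk).
  by apply: (SplitExt_pullback se); catd.
have [z [w [w1 [w2 w3]]]] := Mul_total m (eq_sym (pr_square d c)).
have := Compat_post z (se_compat sx).
have -> : pair hs ;; z = idm G1.
  apply: Mul_fun (gpd_unit_l_Mul gp); exists (pair hs ;; w).
  by rewrite !comp_assoc w1 w2 w3; catd.
have -> // : pair hk ;; z = g.
have M : Mul m g (zero _ _) (pair hk ;; z).
  by exists (pair hk ;; w); rewrite !comp_assoc w1 w2 w3; catd.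
apply: Mul_fun M (Mul_1r (gpd_unit_r_Mul gp) _).
by rewrite gc; catd.
Qed.

(** Here the extension sends [x] and [y] with the same codomain to [x] followed by the
    inverse of [y]. *)
Lemma kappa_compat_cod : Compat (flat_map c (idm _) ;; act G) (idm G1) (g ;; i).
Proof.
have hs : idm G1 ;; c = c ;; e ;; c by rewrite comp_assoc ec; catd.
have hk : zero (xm_top G) G1 ;; c = g ;; c by rewrite gc; catd.
have sx : SplitExt (flat_map c (idm _) ;; act G) (pr1 c c) (pair hs) (pair hk).
  by apply: (SplitExt_pullback se); catd.
have hm : pr1 c c ;; c = pr2 c c ;; i ;; d by rewrite comp_assoc gpd_inv_dom pr_square.
have [z [w [w1 [w2 w3]]]] := Mul_total m hm.
have := Compat_post z (se_compat sx).
have -> : pair hs ;; z = idm G1.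
  apply: Mul_fun (gpd_unit_r_Mul gp); exists (pair hs ;; w).
  by rewrite !comp_assoc w1 w2 w3 -!comp_assoc pair_pr1 pair_pr2 comp_assoc (gpd_inv_unit gp).
have -> // : pair hk ;; z = g ;; i.
have M : Mul m (zero _ _) (g ;; i) (pair hk ;; z).
  by exists (pair hk ;; w); rewrite !comp_assoc w1 w2 w3 -!comp_assoc pair_pr1 pair_pr2.
apply: Mul_fun M (Mul_1l (gpd_unit_l_Mul gp) _).
by rewrite (comp_assoc g) gpd_inv_dom gc; catd.
Qed.

End Inverse.
End Semidirect.

Lemma identity_exists (hs : HuqEqSmith C) (G : CrossedModule C) :
  inhabited {F : Butterfly G G & IdentityOf F}.
Proof.
have [G1 [c [p se]]] : exists G1 (c : Hom G1 (xm_base G)) p,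
    SplitExt (act G) c (inl _ _ ;; p) (inr _ _ ;; p).
  have [G1 [c [e [g se]]]] := semidirect sa (act_action G).
  by exists G1, c, (copair e g); rewrite copair_inl copair_inr.
have cp : IsCoequalizer (flat_j _ _) (act G ;; inr _ _) p.
  have <- : copair (inl _ _ ;; p) (inr _ _ ;; p) = p by apply: copair_uniq; catd.
  exact: (SplitExt_coequalizer sa se).
have [|d [ed gd]] := SplitExt_lift sa (a := idm _) (b := bd G) se.
  by apply/Compat_conj; exact: xm_equivariant.
have ec := se_section se; have kc := se_kernel se; have gc := proj1 kc.
have [m [ml mr]] := unital_exists se ed gd hs.
have [gp _] := unital_groupoid sa ed ec ml mr.
have k1 : inr _ _ ;; p ;; gpd_inv gp ;; c = bd G by rewrite comp_assoc (gpd_inv_cod gp) gd.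
have k2 : inr _ _ ;; p ;; gpd_inv gp ;; d = zero _ _ by rewrite comp_assoc (gpd_inv_dom gp) gc.
have cc : IsCokernel (inr _ _ ;; p) c.
  by apply: (regepi_cokernel sa) => //; apply: (split_regepi sa ec).
have e1 : flat_map (idm G1) (inr _ _ ;; p ;; gpd_inv gp) ;; conj_action G1
          = flat_map c (idm _) ;; act G ;; (inr _ _ ;; p ;; gpd_inv gp).
  by apply/Compat_conj; exact: (kappa_compat_cod se gp).
have e2 : flat_map (idm G1) (inr _ _ ;; p) ;; conj_action G1
          = flat_map d (idm _) ;; act G ;; (inr _ _ ;; p).
  by apply/Compat_conj; exact: (iota_compat_dom se gp).
constructor; exists (Build_Butterfly k1 gd k2 kc cc e1 e2).
exact: (@Build_IdentityOf C G (Build_Butterfly k1 gd k2 kc cc e1 e2) p cp c d gc ec gd ed gp).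
Qed.
End Identity.

(** * The bicategory of butterflies *)

Section Bicategory.
Context (C : PointedCategory) (sa : SemiAbelian C).
Implicit Types A B D T X Y : C.
Implicit Types H G K L M : CrossedModule C.

Let proto : BournProtomodular C := proj1 sa.

Lemma ButterflyMor_ext H G (E E' : Butterfly H G) (f g : ButterflyMor E E') :
  bm f = bm g -> f = g.
Proof.
case: f => f f1 f2 f3 f4; case: g => g g1 g2 g3 g4 /= e.
by subst g; f_equal; apply: proof_irrelevance.
Qed.

Definition id_mor H G (E : Butterfly H G) : ButterflyMor E E :=
  Build_ButterflyMor (comp_id_r (kappa E)) (comp_id_r (iota E))
    (comp_id_l (sigma E)) (comp_id_l (rho E)).

Lemma comp_mor_exists H G (E E' E'' : Butterfly H G) (f : ButterflyMor E E')
    (g : ButterflyMor E' E'') : exists h : ButterflyMor E E'', bm h = f ;; g.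
Proof.
unshelve eexists; first apply: (@Build_ButterflyMor _ _ _ _ _ (f ;; g)); last by [].
- by rewrite -comp_assoc !bm_kappa.
- by rewrite -comp_assoc !bm_iota.
- by rewrite comp_assoc !bm_sigma.
- by rewrite comp_assoc !bm_rho.
Qed.

Lemma ButterflyMor_iso H G (E E' : Butterfly H G) (f : ButterflyMor E E') : IsIso (bm f).
Proof.
exact: (short_five sa (iota_kernel E) (iota_kernel E') (sigma_regepi E) (bm_iota f) (bm_sigma f)).
Qed.

Lemma inv_mor_exists H G (E E' : Butterfly H G) (f : ButterflyMor E E') :
  exists g : ButterflyMor E' E, f ;; g = idm _ /\ g ;; f = idm _.
Proof.
have [g [fg gf]] := ButterflyMor_iso f.
unshelve eexists; first apply: (@Build_ButterflyMor _ _ _ _ _ g); last by [].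
- by rewrite -(bm_kappa f) comp_assoc fg; cat.
- by rewrite -(bm_iota f) comp_assoc fg; cat.
- by rewrite -(bm_sigma f) -comp_assoc gf; cat.
- by rewrite -(bm_rho f) -comp_assoc gf; cat.
Qed.

(** ** Elements of a composite *)

Section Classes.
Context (H G K : CrossedModule C) (E : Butterfly H G) (E' : Butterfly G K) (F : Butterfly H K)
  (w : CompositeOf E E' F).

(** [z] is the class of the pair [(x, y)] of elements of [E] and [E'].  A relation
    avoids carrying the proof that [x] and [y] agree over the base of [G]. *)
Definition Cls T (x : Hom T (bf_ob E)) (y : Hom T (bf_ob E')) (z : Hom T (bf_ob F)) : Prop :=
  exists t, t ;; bf_r E E' = x /\ t ;; bf_s E E' = y /\ t ;; co_q w = z.

Lemma Cls_fun T (x : Hom T (bf_ob E)) (y : Hom T (bf_ob E')) (z z' : Hom T (bf_ob F)) :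
  Cls x y z -> Cls x y z' -> z = z'.
Proof.
move=> [t [t1 [t2 <-]]] [t' [t1' [t2' <-]]]; f_equal.
by apply: pb_ext; rewrite -/(bf_r E E') -/(bf_s E E') ?t1 ?t2 ?t1' ?t2'.
Qed.

Lemma Cls_pre S T (t : Hom S T) (x : Hom T (bf_ob E)) (y : Hom T (bf_ob E'))
    (z : Hom T (bf_ob F)) : Cls x y z -> Cls (t ;; x) (t ;; y) (t ;; z).
Proof. by move=> [v [<- [<- <-]]]; exists (t ;; v); catd. Qed.

Lemma Cls_pair T (x : Hom T (bf_ob E)) (y : Hom T (bf_ob E')) (h : x ;; rho E = y ;; sigma E') :
  Cls x y (pair h ;; co_q w).
Proof. by exists (pair h); rewrite /bf_r /bf_s pair_pr1 pair_pr2. Qed.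

Lemma Cls_total T (x : Hom T (bf_ob E)) (y : Hom T (bf_ob E')) :
  x ;; rho E = y ;; sigma E' -> exists z, Cls x y z.
Proof. by move=> h; eexists; exact: Cls_pair h. Qed.

Lemma Cls_match T (x : Hom T (bf_ob E)) (y : Hom T (bf_ob E')) z :
  Cls x y z -> x ;; rho E = y ;; sigma E'.
Proof. by move=> [t [<- [<- _]]]; rewrite !comp_assoc /bf_r pr_square. Qed.

Lemma Cls_sigma T (x : Hom T (bf_ob E)) (y : Hom T (bf_ob E')) z :
  Cls x y z -> z ;; sigma F = x ;; sigma E.
Proof. by move=> [t [<- [_ <-]]]; rewrite !comp_assoc co_sigma. Qed.

Lemma Cls_rho T (x : Hom T (bf_ob E)) (y : Hom T (bf_ob E')) z :
  Cls x y z -> z ;; rho F = y ;; rho E'.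
Proof. by move=> [t [_ [<- <-]]]; rewrite !comp_assoc co_rho. Qed.

Lemma Cls_kappa : Cls (kappa E) (zero _ _) (kappa F).
Proof. by rewrite (co_kappa w); apply: Cls_pair. Qed.

Lemma Cls_iota : Cls (zero _ _) (iota E') (iota F).
Proof. by rewrite (co_iota w); apply: Cls_pair. Qed.

Lemma Cls_middle : Cls (iota E) (kappa E') (zero _ _).
Proof. by rewrite -(proj1 (co_cokernel w)); apply: Cls_pair. Qed.

Lemma Cls_zero T : Cls (zero T _) (zero T _) (zero T _).
Proof. by move: (Cls_pre (zero T _) Cls_middle); cat. Qed.

Lemma co_regepi : RegularEpi (co_q w).
Proof. exact: cokernel_regepi (co_cokernel w). Qed.

(** [(iota, kappa')] is the kernel of some morphism, by [middle_normal], and that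
    morphism factors through the cokernel [co_q]. *)
Lemma co_kernel : IsKernel (pair (comp_middle_proof E E')) (co_q w).
Proof.
have [Q [q [kq cq]]] := middle_normal sa E E'.
have [h eh] := coker_lift (co_cokernel w) (proj1 cq).
apply: kernel_intro; first exact: (proj1 (co_cokernel w)).
  exact: kernel_mono kq.
by move=> T u u0; apply: (kernel_fac kq); rewrite -eh -comp_assoc u0; cat.
Qed.

Lemma Cls_cover T (z : Hom T (bf_ob F)) :
  exists S (c : Hom S T) x y, RegularEpi c /\ Cls x y (c ;; z).
Proof.
have [S [c [t [rc e]]]] := cover_lift sa z co_regepi.
by exists S, c, (t ;; bf_r E E'), (t ;; bf_s E E'); split=> //; exists t.
Qed.

Lemma Cls_epic Z (f g : Hom (bf_ob F) Z) :
  (forall T (x : Hom T (bf_ob E)) (y : Hom T (bf_ob E')) z, Cls x y z -> z ;; f = z ;; g) ->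
  f = g.
Proof. by move=> e; apply: (regepi_epi co_regepi); apply: e; exists (idm _); catd. Qed.

Lemma Cls_lift Z (f : Hom (BfPb E E') Z) :
  pair (comp_middle_proof E E') ;; f = zero _ _ -> exists g, co_q w ;; g = f.
Proof. exact: coker_lift (co_cokernel w). Qed.

End Classes.

Lemma Cls_epic2 H G K L (E : Butterfly H G) (E' : Butterfly G K) (E'' : Butterfly K L)
    EE' F (w : CompositeOf E E' EE') (v : CompositeOf EE' E'' F) Z (f g : Hom (bf_ob F) Z) :
  (forall T (x : Hom T (bf_ob E)) (y : Hom T (bf_ob E')) (z : Hom T (bf_ob E'')) xy r,
     Cls w x y xy -> Cls v xy z r -> r ;; f = r ;; g) -> f = g.
Proof.
move=> e; apply: (Cls_epic (w := v)) => T xy z r hr.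
have [S [c [x [y [rc hxy]]]]] := Cls_cover w xy.
apply: (regepi_epi rc); rewrite -!comp_assoc.
exact: e hxy (Cls_pre c hr).
Qed.

Lemma Cls_epic3 H G K L M (E1 : Butterfly H G) (E2 : Butterfly G K) (E3 : Butterfly K L)
    (E4 : Butterfly L M) E12 E123 F (w : CompositeOf E1 E2 E12) (v : CompositeOf E12 E3 E123)
    (u : CompositeOf E123 E4 F) Z (f g : Hom (bf_ob F) Z) :
  (forall T (x : Hom T (bf_ob E1)) (y : Hom T (bf_ob E2)) (z : Hom T (bf_ob E3))
       (t : Hom T (bf_ob E4)) xy xyz r,
     Cls w x y xy -> Cls v xy z xyz -> Cls u xyz t r -> r ;; f = r ;; g) -> f = g.
Proof.
move=> e; apply: (Cls_epic2 (w := v) (v := u)) => T xy z t xyz r hxyz hr.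
have [S [c [x [y [rc hxy]]]]] := Cls_cover w xy.
apply: (regepi_epi rc); rewrite -!comp_assoc.
exact: e hxy (Cls_pre c hxyz) (Cls_pre c hr).
Qed.

(** ** Horizontal composition of 2-cells *)

Lemma horizontal_Cls H G K (E F : Butterfly H G) (E' F' : Butterfly G K) EE' FF'
    (w : CompositeOf E E' EE') (w' : CompositeOf F F' FF')
    (f : ButterflyMor E F) (f' : ButterflyMor E' F') (h : Hom (bf_ob EE') (bf_ob FF')) :
  co_q w ;; h = pair (hcomp_proof f f') ;; co_q w' ->
  forall T (x : Hom T (bf_ob E)) y z, Cls w x y z -> Cls w' (x ;; f) (y ;; f') (z ;; h).
Proof.
move=> e T x y z [t [<- [<- <-]]]; exists (t ;; pair (hcomp_proof f f')).
by rewrite !comp_assoc /bf_r /bf_s pair_pr1 pair_pr2 e.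
Qed.

Lemma horizontal_exists H G K (E F : Butterfly H G) (E' F' : Butterfly G K) EE' FF'
    (w : CompositeOf E E' EE') (w' : CompositeOf F F' FF')
    (f : ButterflyMor E F) (f' : ButterflyMor E' F') :
  exists h : ButterflyMor EE' FF', IsHorizontal w w' f f' h.
Proof.
have [|h eh] := Cls_lift w (f := pair (hcomp_proof f f') ;; co_q w').
  apply: (Cls_fun (w := w') (x := iota F) (y := kappa F')); last exact: Cls_middle.
  exists (pair (comp_middle_proof E E') ;; pair (hcomp_proof f f')).
  rewrite -(bm_iota f) -(bm_kappa f').
  by rewrite /bf_r /bf_s !comp_assoc !pair_pr1 !pair_pr2 -!comp_assoc !pair_pr1 !pair_pr2.
have hc := horizontal_Cls eh.
unshelve eexists; first apply: (@Build_ButterflyMor _ _ _ _ _ h); last exact: eh.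
- apply: Cls_fun (Cls_kappa w'); rewrite -(bm_kappa f).
  by move: (hc _ _ _ _ (Cls_kappa w)); cat.
- apply: Cls_fun (Cls_iota w'); rewrite -(bm_iota f').
  by move: (hc _ _ _ _ (Cls_iota w)); cat.
- apply: (Cls_epic (w := w)) => T x y z hz.
  by rewrite -comp_assoc (Cls_sigma (hc _ _ _ _ hz)) (Cls_sigma hz) comp_assoc bm_sigma.
- apply: (Cls_epic (w := w)) => T x y z hz.
  by rewrite -comp_assoc (Cls_rho (hc _ _ _ _ hz)) (Cls_rho hz) comp_assoc bm_rho.
Qed.

(** ** Associativity constraint *)

Section Associativity.
Context (H G K L : CrossedModule C) (E : Butterfly H G) (E' : Butterfly G K) (E'' : Butterfly K L)
  (EE' : Butterfly H K) (E'E'' : Butterfly G L) (w : CompositeOf E E' EE')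
  (w' : CompositeOf E' E'' E'E'') (L1 R1 : Butterfly H L)
  (wl : CompositeOf EE' E'' L1) (wr : CompositeOf E E'E'' R1).

Lemma Triple_elt T (x : Hom T (bf_ob E)) (y : Hom T (bf_ob E')) (z : Hom T (bf_ob E'')) :
  x ;; rho E = y ;; sigma E' -> y ;; rho E' = z ;; sigma E'' ->
  exists t : Hom T (Triple E E' E''),
    t ;; tr1 E E' E'' = x /\ t ;; tr2 E E' E'' = y /\ t ;; tr3 E E' E'' = z.
Proof.
move=> h1 h2.
have h : (pair h1 : Hom T (BfPb E E')) ;; (bf_s E E' ;; rho E') = z ;; sigma E''.
  by rewrite -comp_assoc /bf_s pair_pr2.
exists (pair h); rewrite /tr1 /tr2 /tr3 /tr12 /bf_r /bf_s -!comp_assoc.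
by rewrite pair_pr1 pair_pr2 pair_pr1 pair_pr2.
Qed.

Lemma tr_left_Cls T (t : Hom T (Triple E E' E'')) u :
  Cls w (t ;; tr1 E E' E'') (t ;; tr2 E E' E'') u ->
  Cls wl u (t ;; tr3 E E' E'') (t ;; (pair (tr_left_proof E'' w) ;; co_q wl)).
Proof.
move=> hu; exists (t ;; pair (tr_left_proof E'' w)).
rewrite !comp_assoc /bf_r /bf_s pair_pr1 pair_pr2; split; last by [].
apply: Cls_fun hu; exists (t ;; tr12 E E' E'').
by rewrite /tr1 /tr2 !comp_assoc.
Qed.

Lemma tr_right_Cls T (t : Hom T (Triple E E' E'')) u :
  Cls w' (t ;; tr2 E E' E'') (t ;; tr3 E E' E'') u ->
  Cls wr (t ;; tr1 E E' E'') u (t ;; (pair (tr_right_proof E w') ;; co_q wr)).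
Proof.
move=> hu; exists (t ;; pair (tr_right_proof E w')).
rewrite !comp_assoc /bf_r /bf_s pair_pr1 pair_pr2; split=> //; split=> //.
apply: Cls_fun hu; exists (t ;; tr23 E E' E'').
by rewrite /tr23 !comp_assoc /bf_r /bf_s pair_pr1 pair_pr2.
Qed.

Lemma associator_Cls (a : Hom (bf_ob L1) (bf_ob R1)) :
  pair (tr_left_proof E'' w) ;; co_q wl ;; a = pair (tr_right_proof E w') ;; co_q wr ->
  forall T (x : Hom T (bf_ob E)) (y : Hom T (bf_ob E')) (z : Hom T (bf_ob E'')) xy yz l r,
    Cls w x y xy -> Cls wl xy z l -> Cls w' y z yz -> Cls wr x yz r -> l ;; a = r.
Proof.
move=> ea T x y z xy yz l r hxy hl hyz hr.
have [t [t1 [t2 t3]]] := Triple_elt (Cls_match hxy) (Cls_match hyz).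
rewrite -t1 -t2 in hxy; rewrite -t2 -t3 in hyz; rewrite -t3 in hl; rewrite -t1 in hr.
rewrite (Cls_fun hr (tr_right_Cls hyz)) (Cls_fun hl (tr_left_Cls hxy)).
by rewrite comp_assoc ea.
Qed.

Lemma associator_image (a : Hom (bf_ob L1) (bf_ob R1)) :
  pair (tr_left_proof E'' w) ;; co_q wl ;; a = pair (tr_right_proof E w') ;; co_q wr ->
  forall T (x : Hom T (bf_ob E)) (y : Hom T (bf_ob E')) (z : Hom T (bf_ob E'')) xy l,
    Cls w x y xy -> Cls wl xy z l -> exists yz, Cls w' y z yz /\ Cls wr x yz (l ;; a).
Proof.
move=> ea T x y z xy l hxy hl.
have [yz hyz] : exists yz, Cls w' y z yz.
  by apply: Cls_total; rewrite -(Cls_rho hxy) (Cls_match hl).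
have [r hr] : exists r, Cls wr x yz r.
  by apply: Cls_total; rewrite (Cls_sigma hyz) (Cls_match hxy).
by exists yz; rewrite (associator_Cls ea hxy hl hyz hr).
Qed.

(** The triple pullback covers the pullback of [EE'] and [E''], with kernel
    [(iota, kappa', 0)], and then [L1], the cokernel of the image of
    [(0, iota', kappa'')].  Both subobjects vanish in [R1]. *)
Lemma associator_exists : exists a : ButterflyMor L1 R1, IsAssociator w w' wl wr a.
Proof.
pose p := pair (tr_left_proof E'' w).
have rp : RegularEpi p.
{ apply: (proj2 (proj1 (proj2 sa)) _ _ _ _ p (tr12 E E' E'') (bf_r EE' E'') (co_q w));
    last exact: co_regepi.
  split; first exact: pair_pr1.
  move=> T u v e.
  have h : v ;; (bf_s E E' ;; rho E') = u ;; bf_s EE' E'' ;; sigma E''.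
    rewrite -(co_rho w) -!comp_assoc -e !comp_assoc; f_equal; exact: pr_square.
  exists (pair h); split.
    split; last exact: pair_pr1.
    apply: pb_ext; rewrite comp_assoc ?pair_pr1 ?pair_pr2.
      by rewrite -comp_assoc pair_pr1 -e.
    by [].
  move=> t [t1 t2]; apply: pb_ext; first by rewrite pair_pr1 t2.
  by rewrite pair_pr2 -t1 comp_assoc /bf_s pair_pr2. }
pose TR := pair (tr_right_proof E w') ;; co_q wr.
have [|a1 ea1] := regepi_kernel_factor sa (f := TR) rp.
  move=> T u u0.
  have u1 : u ;; tr12 E E' E'' ;; co_q w = zero _ _.
    by move: (f_equal (fun z => z ;; bf_r EE' E'') u0); rewrite /p /bf_r; cat.
  have u3 : u ;; tr3 E E' E'' = zero _ _.
    by move: (f_equal (fun z => z ;; bf_s EE' E'') u0); rewrite /p /bf_s; cat.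
  have [x ex] : Fac (u ;; tr12 E E' E'') (pair (comp_middle_proof E E')).
    exact: kernel_fac (co_kernel w) u1.
  have e1 : u ;; tr1 E E' E'' = x ;; iota E.
    by rewrite /tr1 -comp_assoc -ex comp_assoc /bf_r pair_pr1.
  have e2 : u ;; tr2 E E' E'' = x ;; kappa E'.
    by rewrite /tr2 -comp_assoc -ex comp_assoc /bf_s pair_pr2.
  have h1 : Cls w' (u ;; tr2 E E' E'') (u ;; tr3 E E' E'') (x ;; kappa E'E'').
    by rewrite e2 u3; move: (Cls_pre x (Cls_kappa w')); cat.
  apply: Cls_fun (tr_right_Cls h1) _; rewrite e1.
  by move: (Cls_pre x (Cls_middle wr)); cat.
have [|a ea] := Cls_lift wl (f := a1).
  have [t [t1 [t2 t3]]] := Triple_elt (comp_iota_proof E E') (comp_middle_proof E' E'').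
  have -> : pair (comp_middle_proof EE' E'') = t ;; p.
    apply: pb_ext; rewrite comp_assoc ?pair_pr1 ?pair_pr2 //.
    apply: Cls_fun (Cls_iota w) _; exists (t ;; tr12 E E' E'').
    by rewrite !comp_assoc.
  rewrite comp_assoc ea1.
  have h1 : Cls w' (t ;; tr2 E E' E'') (t ;; tr3 E E' E'') (zero _ _).
    by rewrite t2 t3; exact: Cls_middle.
  apply: Cls_fun (tr_right_Cls h1) _; rewrite t1; exact: Cls_zero.
have eq : p ;; co_q wl ;; a = TR by rewrite comp_assoc ea.
have ac := associator_Cls eq.
unshelve eexists; first apply: (@Build_ButterflyMor _ _ _ _ _ a); last exact: eq.
- exact: ac (Cls_kappa w) (Cls_kappa wl) (Cls_zero w' _) (Cls_kappa wr).
- exact: ac (Cls_zero w _) (Cls_iota wl) (Cls_iota w') (Cls_iota wr).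
- apply: (Cls_epic2 (w := w) (v := wl)) => T x y z xy r hxy hr.
  have [yz [hyz hr']] := associator_image eq hxy hr.
  by rewrite -comp_assoc (Cls_sigma hr') (Cls_sigma hr) (Cls_sigma hxy).
- apply: (Cls_epic2 (w := w) (v := wl)) => T x y z xy r hxy hr.
  have [yz [hyz hr']] := associator_image eq hxy hr.
  by rewrite -comp_assoc (Cls_rho hr') (Cls_rho hr) (Cls_rho hyz).
Qed.

End Associativity.

(** ** Unit constraints *)

(** [Y] sends [(h, h')] to the arrow [h] followed by the inverse of [h'].  A morphism
    out of the product is determined by its values at [(h, 0)] and [(0, h')], which
    are [iota] and [kappa]; so [Y] gives access to the identity arrows [bd ;; e],
    its values on the diagonal. *)
Lemma identity_division G (I : Butterfly G G) (i : IdentityOf I) :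
  exists Y : Hom (Prod (xm_top G) (xm_top G)) (bf_ob I),
    (Y ;; rho I = fstp _ _ ;; bd G /\ Y ;; sigma I = sndp _ _ ;; bd G) /\
    prodpair (idm _) (zero _ _) ;; Y = iota I /\ prodpair (zero _ _) (idm _) ;; Y = kappa I /\
    prodpair (idm _) (idm _) ;; Y = bd G ;; io_e i.
Proof.
pose gp := io_groupoid i; pose g := io_g i.
have gc : g ;; io_c i = zero _ _ by exact: io_g_c.
have gd : g ;; io_d i = bd G by exact: io_g_d.
have gid : g ;; gpd_inv gp ;; io_d i = zero _ _ by rewrite comp_assoc (gpd_inv_dom gp).
have gic : g ;; gpd_inv gp ;; io_c i = bd G by rewrite comp_assoc (gpd_inv_cod gp).
rewrite (io_rho i) (io_sigma i) (io_iota i) (io_kappa i) -/g -/gp.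
clearbody g.
have hm : fstp (xm_top G) (xm_top G) ;; g ;; io_c i
          = sndp (xm_top G) (xm_top G) ;; (g ;; gpd_inv gp) ;; io_d i.
  by rewrite !(comp_assoc (fstp _ _)) !(comp_assoc (sndp _ _)) gc gid; cat.
have [Y M] := Mul_total (gpd_mult gp) hm.
exists Y; split; last split; last split.
- have [w [w1 [w2 <-]]] := M; rewrite !(comp_assoc w) (gpd_mult_dom gp) (gpd_mult_cod gp).
  rewrite -!(comp_assoc w) w1 w2.
  by rewrite !(comp_assoc (fstp _ _)) !(comp_assoc (sndp _ _)) gd gic.
- move: (Mul_pre (prodpair (idm _) (zero _ _)) M); cat => M1.
  by apply: Mul_fun M1 (Mul_1r (gpd_unit_r_Mul gp) _); rewrite gc; cat.
- move: (Mul_pre (prodpair (zero _ _) (idm _)) M); cat => M1.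
  by apply: Mul_fun M1 (Mul_1l (gpd_unit_l_Mul gp) _); rewrite gid; cat.
- move: (Mul_pre (prodpair (idm _) (idm _)) M); cat => M1.
  apply: Mul_fun M1 _; move: (Mul_pre g (gpd_inv_r_Mul gp)); cat.
  by rewrite -comp_assoc gd.
Qed.

Section Unitors.
Context (H G : CrossedModule C) (E : Butterfly H G).

Lemma left_unit_Cls (I : Butterfly H H) (i : IdentityOf I) (IE : Butterfly H G)
    (w : CompositeOf I E IE) :
  Cls w (sigma E ;; io_e i) (idm _) (pair (lunit_proof E i) ;; co_q w).
Proof. exact: Cls_pair. Qed.

Lemma right_unit_Cls (I : Butterfly G G) (i : IdentityOf I) (EI : Butterfly H G)
    (w : CompositeOf E I EI) :
  Cls w (idm _) (rho E ;; io_e i) (pair (runit_proof E i) ;; co_q w).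
Proof. exact: Cls_pair. Qed.

(** The inverse of the constraint, [la], sends [y] to the class of [(1, y)].  It
    preserves [kappa] because the class of [(h / h', kappa h)] is zero at [h' = 0],
    is [kappa h'] at [h = 0], and is [la (kappa h)] on the diagonal. *)
Lemma left_unitor_exists (I : Butterfly H H) (i : IdentityOf I) (IE : Butterfly H G)
    (w : CompositeOf I E IE) : exists l : ButterflyMor IE E, IsLeftUnitor i w l.
Proof.
set la := pair (lunit_proof E i) ;; co_q w.
have hla := left_unit_Cls i w; rewrite -/la in hla.
have lk : kappa E ;; la = kappa IE.
{ have [Y [[Yr Ys] [Y1 [Y2 Y3]]]] := identity_division i.
  have [W hW] : exists W, Cls w Y (fstp _ _ ;; kappa E) W.
    by apply: Cls_total; rewrite Yr comp_assoc kappa_sigma.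
  have eW : W = sndp _ _ ;; kappa IE.
  { apply: (prod_epic proto).
    - move: (Cls_pre (prodpair (idm _) (zero _ _)) hW); rewrite Y1; cat => h.
      exact: Cls_fun h (Cls_middle w).
    - move: (Cls_pre (prodpair (zero _ _) (idm _)) hW); rewrite Y2; cat => h.
      exact: Cls_fun h (Cls_kappa w). }
  move: (Cls_pre (prodpair (idm _) (idm _)) hW); rewrite Y3 eW; cat => h.
  apply: Cls_fun h; move: (Cls_pre (kappa E) hla); cat.
  by rewrite -comp_assoc kappa_sigma. }
have li : iota E ;; la = iota IE.
  apply: Cls_fun (Cls_iota w); move: (Cls_pre (iota E) hla).
  by rewrite -comp_assoc (proj1 (iota_kernel E)); cat.
have ls : la ;; sigma IE = sigma E.
  by rewrite (Cls_sigma hla) (io_sigma i) comp_assoc io_e_c; cat.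
have lr : la ;; rho IE = rho E by rewrite (Cls_rho hla); cat.
have [l' [el' _]] := inv_mor_exists (Build_ButterflyMor lk li ls lr).
by exists l'.
Qed.

(** Here [la] sends [x] to the class of [(x, 1)], and it preserves [iota] by the same
    argument for the class of [(iota h', h / h')]. *)
Lemma right_unitor_exists (I : Butterfly G G) (i : IdentityOf I) (EI : Butterfly H G)
    (w : CompositeOf E I EI) : exists r : ButterflyMor EI E, IsRightUnitor i w r.
Proof.
set la := pair (runit_proof E i) ;; co_q w.
have hla := right_unit_Cls i w; rewrite -/la in hla.
have li : iota E ;; la = iota EI.
{ have [Y [[Yr Ys] [Y1 [Y2 Y3]]]] := identity_division i.
  have [W hW] : exists W, Cls w (sndp _ _ ;; iota E) Y W.
    by apply: Cls_total; rewrite Ys comp_assoc iota_rho.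
  have eW : W = fstp _ _ ;; iota EI.
  { apply: (prod_epic proto).
    - move: (Cls_pre (prodpair (idm _) (zero _ _)) hW); rewrite Y1; cat => h.
      exact: Cls_fun h (Cls_iota w).
    - move: (Cls_pre (prodpair (zero _ _) (idm _)) hW); rewrite Y2; cat => h.
      exact: Cls_fun h (Cls_middle w). }
  move: (Cls_pre (prodpair (idm _) (idm _)) hW); rewrite Y3 eW; cat => h.
  apply: Cls_fun h; move: (Cls_pre (iota E) hla); cat.
  by rewrite -comp_assoc iota_rho. }
have lk : kappa E ;; la = kappa EI.
  apply: Cls_fun (Cls_kappa w); move: (Cls_pre (kappa E) hla).
  by rewrite -comp_assoc kappa_rho; cat.
have ls : la ;; sigma EI = sigma E by rewrite (Cls_sigma hla); cat.
have lr : la ;; rho EI = rho E.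
  by rewrite (Cls_rho hla) (io_rho i) comp_assoc io_e_d; cat.
have [r [er _]] := inv_mor_exists (Build_ButterflyMor lk li ls lr).
by exists r.
Qed.

End Unitors.

Lemma mor_section_iso H G (E E' : Butterfly H G) (l : ButterflyMor E E')
    (la : Hom (bf_ob E') (bf_ob E)) :
  la ;; l = idm _ -> bm l ;; la = idm _.
Proof.
move=> e; have [k [k1 k2]] := inv_mor_exists l.
by rewrite -[la]comp_id_r -k1 -(comp_assoc la) e comp_id_l k1.
Qed.

Lemma left_unitor_Cls H G (E : Butterfly H G) (I : Butterfly H H) (i : IdentityOf I)
    (IE : Butterfly H G) (w : CompositeOf I E IE) (l : ButterflyMor IE E) :
  IsLeftUnitor i w l ->
  forall T (y : Hom T (bf_ob E)) z, Cls w (y ;; sigma E ;; io_e i) y z -> z ;; l = y.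
Proof.
move=> e T y z hz.
have := Cls_pre y (left_unit_Cls i w); rewrite comp_id_r -comp_assoc => h.
by rewrite (Cls_fun hz h) comp_assoc e comp_id_r.
Qed.

Lemma left_unitor_cover H G (E : Butterfly H G) (I : Butterfly H H) (i : IdentityOf I)
    (IE : Butterfly H G) (w : CompositeOf I E IE) (l : ButterflyMor IE E) :
  IsLeftUnitor i w l -> Cls w (l ;; sigma E ;; io_e i) l (idm _).
Proof.
move=> e; move: (Cls_pre l (left_unit_Cls i w)).
by rewrite comp_id_r -comp_assoc (mor_section_iso e).
Qed.

Lemma right_unitor_Cls H G (E : Butterfly H G) (I : Butterfly G G) (i : IdentityOf I)
    (EI : Butterfly H G) (w : CompositeOf E I EI) (r : ButterflyMor EI E) :
  IsRightUnitor i w r ->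
  forall T (x : Hom T (bf_ob E)) z, Cls w x (x ;; rho E ;; io_e i) z -> z ;; r = x.
Proof.
move=> e T x z hz.
have := Cls_pre x (right_unit_Cls i w); rewrite comp_id_r -comp_assoc => h.
by rewrite (Cls_fun hz h) comp_assoc e comp_id_r.
Qed.

Lemma right_unitor_cover H G (E : Butterfly H G) (I : Butterfly G G) (i : IdentityOf I)
    (EI : Butterfly H G) (w : CompositeOf E I EI) (r : ButterflyMor EI E) :
  IsRightUnitor i w r -> Cls w r (r ;; rho E ;; io_e i) (idm _).
Proof.
move=> e; move: (Cls_pre r (right_unit_Cls i w)).
by rewrite comp_id_r -comp_assoc (mor_section_iso e).
Qed.

End Bicategory.
(** ** Chosen structure and coherence *)

Definition chosen (T : Type) (h : inhabited T) : T :=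
  proj1_sig (constructive_indefinite_description (fun _ : T => True)
    (match h with inhabits x => ex_intro _ x I end)).

Section Coherence.
Context (C : PointedCategory) (sa : SemiAbelian C) (hs : HuqEqSmith C).
Implicit Types H G K L M : CrossedModule C.

Definition bf_comp H G K (E : Butterfly H G) (E' : Butterfly G K) : Butterfly H K :=
  projT1 (chosen (composite_exists sa E E')).

Definition bf_compP H G K (E : Butterfly H G) (E' : Butterfly G K) :
    CompositeOf E E' (bf_comp E E') :=
  projT2 (chosen (composite_exists sa E E')).

Definition bf_id G : Butterfly G G := projT1 (chosen (identity_exists sa hs G)).

Definition bf_idP G : IdentityOf (bf_id G) := projT2 (chosen (identity_exists sa hs G)).

Definition bf_vcomp H G (E E' E'' : Butterfly H G) (f : ButterflyMor E E')
    (g : ButterflyMor E' E'') : ButterflyMor E E'' :=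
  proj1_sig (constructive_indefinite_description _ (comp_mor_exists f g)).

Lemma bf_vcompE H G (E E' E'' : Butterfly H G) (f : ButterflyMor E E')
    (g : ButterflyMor E' E'') : bm (bf_vcomp f g) = f ;; g.
Proof. exact: proj2_sig (constructive_indefinite_description _ (comp_mor_exists f g)). Qed.

Definition bf_hcomp H G K (E F : Butterfly H G) (E' F' : Butterfly G K)
    (f : ButterflyMor E F) (f' : ButterflyMor E' F') : ButterflyMor (bf_comp E E') (bf_comp F F') :=
  proj1_sig (constructive_indefinite_description _
    (horizontal_exists (bf_compP E E') (bf_compP F F') f f')).

Lemma bf_hcompP H G K (E F : Butterfly H G) (E' F' : Butterfly G K)
    (f : ButterflyMor E F) (f' : ButterflyMor E' F') :
  IsHorizontal (bf_compP E E') (bf_compP F F') f f' (bf_hcomp f f').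
Proof.
exact: proj2_sig (constructive_indefinite_description _
  (horizontal_exists (bf_compP E E') (bf_compP F F') f f')).
Qed.

Definition bf_assoc H G K L (E : Butterfly H G) (E' : Butterfly G K) (E'' : Butterfly K L) :
    ButterflyMor (bf_comp (bf_comp E E') E'') (bf_comp E (bf_comp E' E'')) :=
  proj1_sig (constructive_indefinite_description _
    (associator_exists sa (bf_compP E E') (bf_compP E' E'') (bf_compP _ E'') (bf_compP E _))).

Lemma bf_assocP H G K L (E : Butterfly H G) (E' : Butterfly G K) (E'' : Butterfly K L) :
  IsAssociator (bf_compP E E') (bf_compP E' E'') (bf_compP _ E'') (bf_compP E _)
    (bf_assoc E E' E'').
Proof.
exact: proj2_sig (constructive_indefinite_description _
  (associator_exists sa (bf_compP E E') (bf_compP E' E'') (bf_compP _ E'') (bf_compP E _))).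
Qed.

Definition bf_left H G (E : Butterfly H G) : ButterflyMor (bf_comp (bf_id H) E) E :=
  proj1_sig (constructive_indefinite_description _
    (left_unitor_exists sa (bf_idP H) (bf_compP (bf_id H) E))).

Lemma bf_leftP H G (E : Butterfly H G) : IsLeftUnitor (bf_idP H) (bf_compP (bf_id H) E) (bf_left E).
Proof.
exact: proj2_sig (constructive_indefinite_description _
  (left_unitor_exists sa (bf_idP H) (bf_compP (bf_id H) E))).
Qed.

Definition bf_right H G (E : Butterfly H G) : ButterflyMor (bf_comp E (bf_id G)) E :=
  proj1_sig (constructive_indefinite_description _
    (right_unitor_exists sa (bf_idP G) (bf_compP E (bf_id G)))).

Lemma bf_rightP H G (E : Butterfly H G) :
  IsRightUnitor (bf_idP G) (bf_compP E (bf_id G)) (bf_right E).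
Proof.
exact: proj2_sig (constructive_indefinite_description _
  (right_unitor_exists sa (bf_idP G) (bf_compP E (bf_id G)))).
Qed.

Definition bf_Cls H G K (E : Butterfly H G) (E' : Butterfly G K) :=
  @Cls C H G K E E' _ (bf_compP E E').

Lemma bf_hcomp_Cls H G K (E F : Butterfly H G) (E' F' : Butterfly G K)
    (f : ButterflyMor E F) (f' : ButterflyMor E' F') T (x : Hom T (bf_ob E)) (y : Hom T (bf_ob E'))
    z : bf_Cls x y z -> bf_Cls (x ;; f) (y ;; f') (z ;; bf_hcomp f f').
Proof. exact: horizontal_Cls (bf_hcompP f f') T x y z. Qed.

Lemma bf_assoc_Cls H G K L (E : Butterfly H G) (E' : Butterfly G K) (E'' : Butterfly K L) T
    (x : Hom T (bf_ob E)) (y : Hom T (bf_ob E')) (z : Hom T (bf_ob E'')) xy l :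
  bf_Cls x y xy -> bf_Cls xy z l ->
  exists yz, bf_Cls y z yz /\ bf_Cls x yz (l ;; bf_assoc E E' E'').
Proof. by apply: associator_image; exact: bf_assocP. Qed.

Lemma bf_hcomp_id H G K (E : Butterfly H G) (E' : Butterfly G K) :
  bf_hcomp (id_mor E) (id_mor E') = id_mor (bf_comp E E').
Proof.
apply: ButterflyMor_ext; apply: (Cls_epic (w := bf_compP E E')) => T x y z hz.
have := bf_hcomp_Cls (id_mor E) (id_mor E') hz; rewrite /= !comp_id_r => h.
exact: Cls_fun h hz.
Qed.

Lemma bf_interchange H G K (E E1 E2 : Butterfly H G) (F F1 F2 : Butterfly G K)
    (a : ButterflyMor E E1) (a' : ButterflyMor E1 E2)
    (b : ButterflyMor F F1) (b' : ButterflyMor F1 F2) :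
  bf_hcomp (bf_vcomp a a') (bf_vcomp b b') = bf_vcomp (bf_hcomp a b) (bf_hcomp a' b').
Proof.
apply: ButterflyMor_ext; apply: (Cls_epic (w := bf_compP E F)) => T x y z hz.
rewrite bf_vcompE -comp_assoc.
have := bf_hcomp_Cls a' b' (bf_hcomp_Cls a b hz).
have := bf_hcomp_Cls (bf_vcomp a a') (bf_vcomp b b') hz.
by rewrite !bf_vcompE -!comp_assoc; exact: Cls_fun.
Qed.

Lemma bf_assoc_natural H G K L (E E1 : Butterfly H G) (F F1 : Butterfly G K) (M M1 : Butterfly K L)
    (a : ButterflyMor E E1) (b : ButterflyMor F F1) (c : ButterflyMor M M1) :
  bf_vcomp (bf_hcomp (bf_hcomp a b) c) (bf_assoc E1 F1 M1)
  = bf_vcomp (bf_assoc E F M) (bf_hcomp a (bf_hcomp b c)).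
Proof.
apply: ButterflyMor_ext; rewrite !bf_vcompE.
apply: (Cls_epic2 sa (w := bf_compP E F) (v := bf_compP _ M)) => T x y z xy r hxy hr.
rewrite -!comp_assoc.
have [yz [hyz hr']] := bf_assoc_Cls hxy hr.
have [yz1 [hyz1 h1]] := bf_assoc_Cls (bf_hcomp_Cls a b hxy) (bf_hcomp_Cls (bf_hcomp a b) c hr).
have h2 := bf_hcomp_Cls a (bf_hcomp b c) hr'.
rewrite (Cls_fun hyz1 (bf_hcomp_Cls b c hyz)) in h1.
exact: Cls_fun h1 h2.
Qed.

Lemma bf_left_natural H G (E E1 : Butterfly H G) (a : ButterflyMor E E1) :
  bf_vcomp (bf_hcomp (id_mor (bf_id H)) a) (bf_left E1) = bf_vcomp (bf_left E) a.
Proof.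
apply: ButterflyMor_ext; rewrite !bf_vcompE.
have h := bf_hcomp_Cls (id_mor (bf_id H)) a (left_unitor_cover sa (bf_leftP E)).
rewrite -[LHS]comp_id_l -comp_assoc; apply: (left_unitor_Cls (bf_leftP E1)).
move: h => /=; rewrite comp_id_r.
by rewrite !comp_assoc -(comp_assoc a) bm_sigma.
Qed.

Lemma bf_right_natural H G (E E1 : Butterfly H G) (a : ButterflyMor E E1) :
  bf_vcomp (bf_hcomp a (id_mor (bf_id G))) (bf_right E1) = bf_vcomp (bf_right E) a.
Proof.
apply: ButterflyMor_ext; rewrite !bf_vcompE.
have h := bf_hcomp_Cls a (id_mor (bf_id G)) (right_unitor_cover sa (bf_rightP E)).
rewrite -[LHS]comp_id_l -comp_assoc; apply: (right_unitor_Cls (bf_rightP E1)).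
move: h => /=; rewrite comp_id_r.
by rewrite !comp_assoc -(comp_assoc a) bm_rho.
Qed.

Lemma bf_pentagon H G K L M (f : Butterfly H G) (g : Butterfly G K) (h : Butterfly K L)
    (k : Butterfly L M) :
  bf_vcomp (bf_assoc (bf_comp f g) h k) (bf_assoc f g (bf_comp h k))
  = bf_vcomp (bf_vcomp (bf_hcomp (bf_assoc f g h) (id_mor k)) (bf_assoc f (bf_comp g h) k))
           (bf_hcomp (id_mor f) (bf_assoc g h k)).
Proof.
apply: ButterflyMor_ext; rewrite !bf_vcompE.
apply: (Cls_epic3 sa (w := bf_compP f g) (v := bf_compP _ h) (u := bf_compP _ k))
  => T x y z t xy xyz r hxy hxyz hr.
rewrite -!comp_assoc.
have [zt [hzt h1]] := bf_assoc_Cls hxyz hr.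
have [yzt [hyzt h2]] := bf_assoc_Cls hxy h1.
have [yz [hyz h3]] := bf_assoc_Cls hxy hxyz.
have := bf_hcomp_Cls (bf_assoc f g h) (id_mor k) hr; rewrite /= comp_id_r => h4.
have [u [hu h5]] := bf_assoc_Cls h3 h4.
have [zt' [hzt' h6]] := bf_assoc_Cls hyz hu.
have := bf_hcomp_Cls (id_mor f) (bf_assoc g h k) h5; rewrite /= comp_id_r => h7.
rewrite (Cls_fun hzt' hzt) in h6; rewrite (Cls_fun h6 hyzt) in h7.
exact: Cls_fun h2 h7.
Qed.

(** The right unit constraint is invertible, so every element of [f I] is the class of
    some [(x, 1)]; both sides send the class of [((x, 1), z)] to that of [(x, z)]. *)
Lemma bf_triangle H G K (f : Butterfly H G) (g : Butterfly G K) :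
  bf_vcomp (bf_assoc f (bf_id G) g) (bf_hcomp (id_mor f) (bf_left g))
  = bf_hcomp (bf_right f) (id_mor g).
Proof.
apply: ButterflyMor_ext; rewrite !bf_vcompE.
apply: (Cls_epic (w := bf_compP _ g)) => T u z v hv; rewrite -!comp_assoc.
have hu := Cls_pre u (right_unitor_cover sa (bf_rightP f)); rewrite comp_id_r in hu.
have := bf_hcomp_Cls (bf_right f) (id_mor g) hv; rewrite /= comp_id_r => h1.
have [yz [hyz h2]] := bf_assoc_Cls hu hv.
have := bf_hcomp_Cls (id_mor f) (bf_left g) h2; rewrite /= comp_id_r => h3.
have eyz : yz ;; bf_left g = z.
  apply: (left_unitor_Cls (bf_leftP g)); rewrite -(Cls_match hv) -(bm_rho (bf_right f)).
  by move: hyz; rewrite !comp_assoc.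
rewrite eyz in h3; exact: Cls_fun h3 h1.
Qed.

Definition butterfly_bicategory : Bicategory (@ButterflyMor C).
Proof.
refine (@Build_Bicategory (CrossedModule C) (@Butterfly C) (@ButterflyMor C)
  (@id_mor C) (@bf_vcomp) _ _ _ _ bf_id bf_comp bf_hcomp bf_hcomp_id bf_interchange
  bf_assoc bf_assoc_natural
  bf_left bf_left_natural bf_right bf_right_natural bf_pentagon bf_triangle).
- by move=> H G f g a; apply: ButterflyMor_ext; rewrite bf_vcompE comp_id_l.
- by move=> H G f g a; apply: ButterflyMor_ext; rewrite bf_vcompE comp_id_r.
- by move=> H G f g h k a b c; apply: ButterflyMor_ext; rewrite !bf_vcompE comp_assoc.
- move=> H G f g a; have [b [ab ba]] := inv_mor_exists sa a.
  by exists b; split; apply: ButterflyMor_ext; rewrite bf_vcompE.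
Defined.

End Coherence.

Theorem proposition3p8 (C : PointedCategory) (semi_abelian : SemiAbelian C)
    (huq_smith : HuqEqSmith C) :
  exists (B : Bicategory (@ButterflyMor C))
    (cw : forall (H G K : CrossedModule C) (E : Butterfly H G) (E' : Butterfly G K),
        CompositeOf E E' (comp1 B E E'))
    (iw : forall G : CrossedModule C, IdentityOf (id1 B G)),
  (forall (H G : CrossedModule C) (E : Butterfly H G),
      bm (vid B E) = idm (bf_ob E)) /\
  (forall (H G : CrossedModule C) (E E' E'' : Butterfly H G)
      (f : ButterflyMor E E') (g : ButterflyMor E' E''),
      bm (vcomp B f g) = bm f ;; bm g) /\
  (forall (H G K : CrossedModule C) (E F : Butterfly H G) (E' F' : Butterfly G K)
      (f : ButterflyMor E F) (f' : ButterflyMor E' F'),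
      IsHorizontal (cw H G K E E') (cw H G K F F') f f' (hcomp B f f')) /\
  (forall (H G K L : CrossedModule C)
      (E : Butterfly H G) (E' : Butterfly G K) (E'' : Butterfly K L),
      IsAssociator (cw H G K E E') (cw G K L E' E'')
        (cw H K L (comp1 B E E') E'') (cw H G L E (comp1 B E' E''))
        (associator B E E' E'')) /\
  (forall (H G : CrossedModule C) (E : Butterfly H G),
      IsLeftUnitor (iw H) (cw H H G (id1 B H) E) (left_unitor B E)) /\
  (forall (H G : CrossedModule C) (E : Butterfly H G),
      IsRightUnitor (iw G) (cw H G G E (id1 B G)) (right_unitor B E)).
Proof.
exists (butterfly_bicategory semi_abelian huq_smith),
  (@bf_compP C semi_abelian), (@bf_idP C semi_abelian huq_smith).
split; first by [].
split; first by move=> H G E E' E'' f g; exact: bf_vcompE.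
split; first by move=> H G K E F E' F' f f'; exact: bf_hcompP.
split; first by move=> H G K L E E' E''; exact: bf_assocP.
split=> H G E; [exact: bf_leftP | exact: bf_rightP].
Qed.
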